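(* A signed colored graph satisfies Axioms 1, 2, 3, $4^+$, and 5 if and only if it is a dual equivalence graph.
   Context: Tableaux are in French notation; the row reading word reads rows left to right starting from the top row. For $w\in S_n$, $\sigma(w)_i=+1$ if $i$ precedes $i+1$ in $w$, else $-1$; a tableau's signature is that of its row reading word. For $1<i<n$, $d_i$ fixes $w$ if $i$ lies positionally between $i-1$ and $i+1$, otherwise swaps $i$ with whichever of $i\pm1$ is not in the middle of the three positions; it acts on standard tableaux via row reading words. $\mathcal G_\lambda$ ($\lambda\vdash n$) has vertices $\mathrm{SYT}(\lambda)$, tableau signatures, and $i$-edges $\{T,d_i(T)\}$, $d_i(T)\ne T$, $1<i<n$. A signed colored graph $(V,\sigma,E_{m+1}\cup\dots\cup E_{n-1})$: a finite set $V$, for each $m<i<n$ ($m,n$ positive integers) a set $E_i$ of unordered pairs of distinct vertices, and $\sigma\colon V\to\{\pm1\}^{N-1}$, $N\ge n$. An edge colored graph is the same without $\sigma$; an isomorphism of edge colored graphs is a bijection on vertices preserving $i$-edges in both directions. A vertex $v$ admits an $i$-neighbor if $\sigma(v)_{i-1}=-\sigma(v)_i$. Axioms: (Ax1) for $m<i<n$, $E_i$ is a complete matching on the vertices admitting an $i$-neighbor; (Ax2) if $\{v,w\}\in E_i$ then $\sigma(v)_i=-\sigma(w)_i$, $\sigma(v)_{i-1}=-\sigma(w)_{i-1}$, and $\sigma(v)_h=\sigma(w)_h$ for $h<i-2$ and $h>i+1$; (Ax3) for $\{v,w\}\in E_i$: if $\sigma_{i-2}$ is defined then $v$ or $w$ admits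 an $(i-1)$-neighbor; if $\sigma_{i+1}$ is defined then $v$ or $w$ admits an $(i+1)$-neighbor; (Ax4) for $m+1<i<n$, each connected component of the edge colored graph $(V,E_{i-2}\cup E_{i-1}\cup E_i)$ is isomorphic to a component of $(V',E'_{i-2}\cup E'_{i-1}\cup E'_i)$ for some $\mathcal G_\lambda=(V',\sigma',E')$ ($E_{i-2}$ omitted if $i=m+2$); (Ax$4^+$) for $m+1<i<n$, each connected component of the edge colored graph $(V,E_{i-3}\cup E_{i-2}\cup E_{i-1}\cup E_i)$ is isomorphic to a component of $(V',E'_{i-3}\cup E'_{i-2}\cup E'_{i-1}\cup E'_i)$ for some $\mathcal G_\lambda=(V',\sigma',E')$, where $E_{i-3}$ is omitted if $i\le m+3$ and $E_{i-2}$ is omitted if $i\le m+2$; (Ax5) if $|i-j|>2$, $\{v,w\}\in E_i$, $\{w,x\}\in E_j$, then some $y$ has $\{v,y\}\in E_j$ and $\{x,y\}\in E_i$; (Ax6) for $m<i<n$, any two vertices in one connected component of $(V,\sigma,E_{m+1}\cup\dots\cup E_i)$ are joined by a path using at most one edge of $E_i$. A dual equivalence graph is a signed colored graph satisfying Axioms 1–6. *)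

(* Defs.v *)
From mathcomp Require Import all_boot.

Set Implicit Arguments.
Unset Strict Implicit.
Unset Printing Implicit Defensive.

(* The set E_i of unordered pairs of distinct vertices is encoded as an
   irreflexive symmetric relation, empty unless m < i < n. *)
Record ecgraph (m n : nat) : Type := ECGraph {
  vertex :> finType;
  edge : nat -> rel vertex;
  edge_sym : forall i, symmetric (edge i);
  edge_irr : forall i, irreflexive (edge i);
  edge_range : forall i v w, edge i v w -> m < i < n
}.

(* Signs are booleans: true stands for +1, false for -1, ~~ for negation. *)
Record scgraph (m n N : nat) : Type := SCGraph {
  ecgraph_of :> ecgraph m n;
  signature : vertex ecgraph_of -> N.-1.-tuple bool
}.

(* sgn v h is sigma(v)_h, meaningful only for the 1-based indices
   1 <= h <= N - 1. *)
Definition sgn m n N (G : scgraph m n N) (v : G) (h : nat) : bool :=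
  nth false (signature v) h.-1.

Section EdgeColoredGraphs.
Variables m n : nat.
Implicit Type G : ecgraph m n.

Definition adjacent G : rel G := [rel v w | [exists i : 'I_n, edge i v w]].

Definition connected G : rel G := connect (@adjacent G).

(* A path is recorded as its list of (colour, next vertex) steps, since one
   pair of vertices may be an edge of several colours. *)
Fixpoint is_walk G (v : G) (p : seq (nat * G)) (w : G) : bool :=
  if p is (i, u) :: p' then edge i v u && is_walk u p' w else v == w.

Section Restriction.
Variables (a b : nat) (G : ecgraph m n).

Definition restrict_edge (i : nat) : rel G :=
  [rel v w | (a < i < b) && edge i v w].

Fact restrict_sym i : symmetric (restrict_edge i).
Proof. by move=> v w; rewrite /restrict_edge /= edge_sym. Qed.

Fact restrict_irr i : irreflexive (restrict_edge i).
Proof. by move=> v; rewrite /restrict_edge /= edge_irr andbF. Qed.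

Fact restrict_range i v w : restrict_edge i v w -> a < i < b.
Proof. by case/andP. Qed.

(* The edge colored graph (V, E_{a+1} \cup ... \cup E_{b-1}). *)
Definition restrict : ecgraph a b :=
  ECGraph restrict_sym restrict_irr restrict_range.

End Restriction.

Section Component.
Variables (G : ecgraph m n) (v : G).

Definition component_vertex : finType := {w : G | connected v w}.

Definition component_edge (i : nat) : rel component_vertex :=
  [rel x y | edge i (val x) (val y)].

Fact component_sym i : symmetric (component_edge i).
Proof. by move=> x y; rewrite /component_edge /= edge_sym. Qed.

Fact component_irr i : irreflexive (component_edge i).
Proof. by move=> x; rewrite /component_edge /= edge_irr. Qed.

Fact component_range i x y : component_edge i x y -> m < i < n.
Proof. exact: edge_range. Qed.

Definition component : ecgraph m n :=
  ECGraph component_sym component_irr component_range.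

End Component.

Definition ec_isomorphic (G H : ecgraph m n) : Prop :=
  exists f : G -> H,
    bijective f /\ forall i v w, edge i (f v) (f w) = edge i v w.

End EdgeColoredGraphs.

Definition is_partition (lam : seq nat) : bool :=
  sorted geq lam && (0 \notin lam).

(* A tableau is the list of its rows, bottom row first (French notation), so
   each row lies directly above the previous one; zip truncates to the length
   of the upper row. *)
Definition is_syt (lam : seq nat) (t : seq (seq nat)) : bool :=
  [&& shape t == lam,
      perm_eq (flatten t) (iota 1 (sumn lam)),
      all (sorted ltn) t
    & sorted (fun r r' => all (fun xy => xy.1 < xy.2) (zip r r')) t].

Definition syt_seq (lam : seq nat) : seq (seq (seq nat)) :=
  [seq t <- [seq reshape lam w | w <- permutations (iota 1 (sumn lam))]
  | is_syt lam t].

Lemma mem_syt_seq lam t : (t \in syt_seq lam) = is_syt lam t.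
Proof.
rewrite mem_filter; apply/andb_idr => /and4P[/eqP <- tP _ _].
by apply/mapP; exists (flatten t); rewrite ?flattenK // mem_permutations.
Qed.

Definition syt (lam : seq nat) : finType := seq_sub (syt_seq lam).

Definition reading_word (t : seq (seq nat)) : seq nat := flatten (rev t).

Definition between (p q r : nat) : bool := (p < q < r) || (r < q < p).

Definition swap (a b : nat) (w : seq nat) : seq nat :=
  map [fun x => x with a |-> b, b |-> a] w.

Definition dual_equiv (i : nat) (w : seq nat) : seq nat :=
  let pos j := index j w in
  if between (pos i.-1) (pos i) (pos i.+1) then w
  else if between (pos i) (pos i.-1) (pos i.+1) then swap i i.+1 w
  else swap i i.-1 w.

Definition word_signature (n : nat) (w : seq nat) : n.-1.-tuple bool :=
  [tuple index k.+1 w < index k.+2 w | k < n.-1].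

Section StandardGraph.
Variable lam : seq nat.
Local Notation n := (sumn lam).

(* A tableau of given shape is determined by its reading word, so
   U = d_i(T) is expressed on reading words. *)
Definition syt_edge (i : nat) : rel (syt lam) :=
  [rel T U | let w := reading_word (val T) in let w' := reading_word (val U) in
    [&& 1 < i < n, T != U & (w' == dual_equiv i w) || (w == dual_equiv i w')]].

Fact syt_edge_sym i : symmetric (syt_edge i).
Proof. by move=> T U; rewrite /syt_edge /= eq_sym orbC. Qed.

Fact syt_edge_irr i : irreflexive (syt_edge i).
Proof. by move=> T; rewrite /syt_edge /= eqxx andbF. Qed.

Fact syt_edge_range i T U : syt_edge i T U -> 1 < i < n.
Proof. by case/andP. Qed.

Definition syt_graph : scgraph 1 n n :=
  @SCGraph 1 n n (ECGraph syt_edge_sym syt_edge_irr syt_edge_range)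
    (fun T : syt lam => word_signature n (reading_word (val T))).

End StandardGraph.

Section DualEquivalence.
Variables m n N : nat.
Implicit Type G : scgraph m n N.

Definition admits G (v : G) (i : nat) : bool := sgn v i.-1 == ~~ sgn v i.

Definition axiom1 G : Prop :=
  forall i, m < i < n ->
    (forall v w : G, edge i v w -> admits v i) /\
    (forall v : G, admits v i -> exists! w : G, edge i v w).

Definition axiom2 G : Prop :=
  forall i (v w : G), edge i v w ->
    [/\ sgn v i = ~~ sgn w i,
        sgn v i.-1 = ~~ sgn w i.-1
      & forall h, 1 <= h <= N.-1 -> (h + 2 < i) || (i + 1 < h) ->
          sgn v h = sgn w h].

Definition axiom3 G : Prop :=
  forall i (v w : G), edge i v w ->
    (1 <= i - 2 -> admits v i.-1 \/ admits w i.-1) /\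
    (i.+1 <= N.-1 -> admits v i.+1 \/ admits w i.+1).

(* Every component of (V, E_{a+1} \cup ... \cup E_{b-1}) is isomorphic to a
   component of the same union in some G_lambda; b <= |lambda| guarantees that
   G_lambda has edge sets of all these colours. *)
Definition locally_syt G (a b : nat) : Prop :=
  forall v : restrict a b G,
    exists (lam : seq nat) (T : restrict a b (syt_graph lam)),
      [/\ is_partition lam, b <= sumn lam
        & ec_isomorphic (component v) (component T)].

(* The lower bound maxn m (i - k) drops the edge sets whose index is at
   most m. *)
Definition axiom4 G : Prop :=
  forall i, m.+1 < i < n -> locally_syt G (maxn m (i - 3)) i.+1.

Definition axiom4plus G : Prop :=
  forall i, m.+1 < i < n -> locally_syt G (maxn m (i - 4)) i.+1.

Definition axiom5 G : Prop :=
  forall i j (v w x : G), (i + 2 < j) || (j + 2 < i) ->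
    edge i v w -> edge j w x ->
    exists y : G, edge j v y /\ edge i x y.

Definition axiom6 G : Prop :=
  forall i, m < i < n ->
  forall v w : restrict m i.+1 G, connected v w ->
    exists2 p, is_walk v p w & count (fun s => s.1 == i) p <= 1.

Definition dual_equivalence_graph G : Prop :=
  [/\ axiom1 G, axiom2 G & axiom3 G] /\ [/\ axiom4 G, axiom5 G & axiom6 G].

End DualEquivalence.

(* Main.v *)
(* Label the vertices by standard tableaux, one letter at a time. Suppose each
   component of the lower colours is labelled isomorphically by the tableaux of
   one shape. The next sign depends only on the corner of the last letter, and
   Axiom 3 makes it monotone in that corner, so it is the sign produced by adding
   the new letter in a unique addable cell. The labelling respects the edges of
   the new top colour: if the new letter lies between the two preceding ones, a
   suitable choice of the lower letters turns the edge into a double edge;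
   otherwise the third last letter keeps its cell, and moving it through all
   corners between the last two (commuting squares) pins down their cells. So
   the labelled graph covers the graph of tableaux of one shape.

   Under Axiom 6 two vertices with equal labels are joined by a path with at most
   one top edge, which forces them to coincide. Under Axiom 4+ components of
   four colours have at most 16 vertices. For three corners of the shape one
   finds a class of 16 tableaux, the class of shape (3,2,1), moving the last
   three letters around these corners; it is covered bijectively, and this
   closes up any two consecutive top edges into one, which is Axiom 6. Finally
   a graph labelled isomorphically by the tableaux of one shape satisfies every
   local axiom, once the letters below m are added to the bottom row. *)

Require Import Defs.
From mathcomp Require Import all_boot.
From mathcomp Require Import zify.

Set Implicit Arguments.
Unset Strict Implicit.
Unset Printing Implicit Defensive.

(** * Lattice words and dual equivalence moves *)

(** A tableau is stored as the list of the rows of its letters. Restricting it to fewer letters is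
    taking a prefix, two tableaux have one shape when their lists are permutations of each other,
    and a dual equivalence move compares three neighbouring entries only.

    The obstacle is injectivity. The labels are read off from signs, and vertices of one component
    that are joined only through several top edges might carry the same label. Both directions
    therefore build the same covering by tableaux, and differ in how they show that one top edge
    always suffices: Axiom 6 says so, while under Axiom 4+ it follows from a closed walk through
    three corners. The next letter can be added only after this, since its sign is a function of the
    label only if labels separate the vertices of a component.

    The local isomorphisms are used by counting. The largest numbers of tableaux with 4, 5 and 6
    cells, namely 3, 6 and 16, belong to the shapes (3,1), (3,1,1) and (3,2,1); a configuration that
    broke the rule of tableaux would contain one vertex more. *)

Ltac blia :=
  repeat match goal with
  | |- context [nat_of_bool (?x == ?y)] =>
      case: (eqVneq x y) => [?|?]; [try subst|]; rewrite ?eqxx /=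
  end; lia.

Section Run.
Variables (T : Type) (E : nat -> T -> T).
Definition run (v : T) (cs : seq nat) : T := foldl (fun u c => E c u) v cs.

Lemma run_cons v c cs : run v (c :: cs) = run (E c v) cs.
Proof. by []. Qed.

Lemma run_cat v cs cs' : run v (cs ++ cs') = run (run v cs) cs'.
Proof. by rewrite /run foldl_cat. Qed.

Lemma run_rcons v cs c : run v (rcons cs c) = E c (run v cs).
Proof. by rewrite /run foldl_rcons. Qed.

Lemma run_revK (P : pred nat) v cs :
  (forall c u, P c -> E c (E c u) = u) -> all P cs -> run (run v cs) (rev cs) = v.
Proof.
move=> EK; elim: cs v => //= c cs IH v /andP[Pc Pcs].
by rewrite rev_cons run_rcons IH // EK.
Qed.
End Run.

(* Here x, y, z are the rows of three consecutive letters. A letter precedes a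
   larger one in the reading word exactly when its row is at least as high. *)
Definition move3 (x y z : nat) : seq nat :=
  if (y <= x) == (z <= y) then [:: x; y; z]
  else if (y <= x) == (z <= x) then [:: y; x; z] else [:: x; z; y].

Fixpoint dmove (c : nat) (t : seq nat) : seq nat :=
  match c, t with
  | 0, [:: x, y, z & r] => move3 x y z ++ r
  | c'.+1, x :: r => x :: dmove c' r
  | _, _ => t
  end.

Lemma dmove_cat c s r : dmove (size s + c) (s ++ r) = s ++ dmove c r.
Proof. by elim: s => //= x s ->. Qed.

Lemma dmove_catl c s r : c.+2 < size s -> dmove c (s ++ r) = dmove c s ++ r.
Proof.
elim: c s => [|c IH] [|x s] //=; last by rewrite ltnS => /IH ->.
by case: s => [|y [|z s]] //= _; rewrite catA.
Qed.

Lemma perm_move3 x y z : perm_eq (move3 x y z) [:: x; y; z].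
Proof.
rewrite /move3; case: ifP => // _; case: ifP => // _; last first.
  by rewrite perm_cons; apply/permP => p /=; lia.
by apply/permP => p /=; lia.
Qed.

Lemma perm_dmove c t : perm_eq (dmove c t) t.
Proof.
elim: c t => [|c IH] [|x t] //=; last by rewrite perm_cons.
case: t => [|y [|z t]] //=.
by rewrite -[_ :: _]/([:: x; y; z] ++ t) perm_cat2r perm_move3.
Qed.

Lemma size_dmove c t : size (dmove c t) = size t.
Proof. exact/perm_size/perm_dmove. Qed.

Lemma dmoveK c : involutive (dmove c).
Proof.
elim: c => [|c IH] [|x t] //=; last by rewrite IH.
case: t => [|y [|z t]] //=; rewrite /move3.
case: (leqP y x) => xy; case: (leqP z y) => yz; case: (leqP z x) => xz //=;
  rewrite /move3 ?xy ?yz ?xz //=; do ?[case: (leqP _ _) => ? //=]; lia.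
Qed.

Lemma perm_run cs t : perm_eq (run dmove t cs) t.
Proof.
elim/last_ind: cs => //= cs c IH; rewrite run_rcons.
exact: perm_trans (perm_dmove _ _) IH.
Qed.

Lemma size_run cs t : size (run dmove t cs) = size t.
Proof. exact/perm_size/perm_run. Qed.

Lemma run_dmove_cat cs s r : all (fun c => c.+2 < size s) cs ->
  run dmove (s ++ r) cs = run dmove s cs ++ r.
Proof.
elim/last_ind: cs => //= cs c IH; rewrite all_rcons !run_rcons => /andP[cs1 /IH ->].
by rewrite dmove_catl // size_run.
Qed.

(** * Corners of shapes and lattice words *)

Definition cnt (r : nat) (s : seq nat) : nat := count_mem r s.

Lemma cnt_perm r s s' : perm_eq s s' -> cnt r s = cnt r s'.
Proof. by move=> /permP e; exact: e. Qed.

Lemma cnt_cat r s s' : cnt r (s ++ s') = cnt r s + cnt r s'.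
Proof. exact: count_cat. Qed.

Lemma cnt_rcons r s x : cnt r (rcons s x) = cnt r s + (x == r).
Proof. by rewrite -cats1 cnt_cat /cnt /= addn0. Qed.

Definition addable (r : nat) (s : seq nat) : bool :=
  (r == 0) || (cnt r s < cnt r.-1 s).

Definition removable (r : nat) (s : seq nat) : bool :=
  cnt r.+1 s < cnt r s.

Fixpoint yam_from (s r : seq nat) : bool :=
  if r is x :: r' then addable x s && yam_from (rcons s x) r' else true.

(* Lattice words, i.e. standard tableaux recorded as the row of each letter. *)
Definition yam (t : seq nat) : bool := yam_from [::] t.

Lemma yam_cat s r : yam (s ++ r) = yam s && yam_from s r.
Proof.
suff H u : yam_from u (s ++ r) = yam_from u s && yam_from (u ++ s) r by exact: H.
elim: s u => [|x s IH] u /=; first by rewrite cats0.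
by rewrite IH -cat_rcons andbA.
Qed.

Lemma yam_rcons s x : yam (rcons s x) = yam s && addable x s.
Proof. by rewrite -cats1 yam_cat /= andbT. Qed.

Lemma addable_perm r s s' : perm_eq s s' -> addable r s = addable r s'.
Proof. by move=> pe; rewrite /addable !(cnt_perm _ pe). Qed.

Lemma removable_perm r s s' : perm_eq s s' -> removable r s = removable r s'.
Proof. by move=> pe; rewrite /removable !(cnt_perm _ pe). Qed.

Lemma yam_cnt r t : yam t -> cnt r.+1 t <= cnt r t.
Proof.
elim/last_ind: t => // t x IH; rewrite yam_rcons => /andP[/IH le].
rewrite /addable !cnt_rcons; move=> /orP[/eqP->|]; first by lia.
by case: (eqVneq x r.+1) => [->|] /=; blia.
Qed.

Lemma removable_last t r : yam (rcons t r) -> removable r (rcons t r).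
Proof.
rewrite yam_rcons => /andP[/(yam_cnt r) le _].
by rewrite /removable !cnt_rcons; blia.
Qed.

Lemma removable_rcons t r x : x != r -> yam (rcons t x) ->
  removable r (rcons t x) -> removable r t.
Proof.
by rewrite yam_rcons /removable !cnt_rcons /addable => xr /andP[_]; blia.
Qed.

(** If the last letter [x] is in another row, [r] is still a corner of the rest, where by induction
    it can hold the last letter. Then [r] and [x] are exchanged, which is possible because both rows
    end in corners of the whole shape. *)
Lemma removable_to_end t r : yam t -> removable r t ->
  exists2 u, yam (rcons u r) & perm_eq (rcons u r) t.
Proof.
elim/last_ind: t => [|t x IH] //; rewrite yam_rcons => /andP[yt ax].
case: (eqVneq x r) => [<- _|xr rem]; first by exists t => //; rewrite yam_rcons yt.
have remt : removable r t by apply: removable_rcons rem; rewrite ?yam_rcons ?yt.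
have [u yu pu] := IH yt remt.
have := yu; rewrite yam_rcons => /andP[yu' ar].
have eqc y : cnt y t = cnt y u + (r == y) by rewrite -cnt_rcons (cnt_perm _ pu).
have axu : addable x u.
  move: ax rem; rewrite /addable /removable !cnt_rcons !eqc.
  by case: x xr {IH} => [|x] //= xr; blia.
exists (rcons u x).
  rewrite !yam_rcons yu' axu /=; move: ar; rewrite /addable !cnt_rcons.
  by case: r xr {rem remt IH yu pu eqc} => [|r] //= xr; blia.
apply: perm_trans (_ : perm_eq (rcons (rcons u r) x) _).
  by rewrite -!cats1 perm_catAC.
by rewrite -!cats1 perm_cat2r cats1.
Qed.

(* In reading order the new corner lies between the two removed cells. *)
Lemma removable_between t s lo hi : yam t -> removable lo t -> removable hi t ->
  lo < hi -> perm_eq (s ++ [:: lo; hi]) t -> removable hi.-1 s.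
Proof.
move=> yt rlo rhi lt pe.
have eqc y : cnt y t = cnt y s + (lo == y) + (hi == y).
  by rewrite -(cnt_perm _ pe) cnt_cat /cnt /=; lia.
case: hi lt rhi eqc pe => // hi; rewrite ltnS => lt rhi eqc _ /=.
have := yam_cnt hi yt; move: rlo rhi; rewrite /removable !eqc.
by case: (eqVneq lo hi) => [->|]; blia.
Qed.

Lemma addable_pred x s : addable x s -> 0 < x -> removable x.-1 s.
Proof. by case: x => //= x; rewrite /addable /removable. Qed.

(** Addable and removable rows alternate: if [x < x'] are addable, row [x'.-1] is a corner that
    separates them. Hence an addable row is known from its comparisons with all corners. *)
Lemma addable_inj s x x' : addable x s -> addable x' s ->
  (forall r, removable r s -> (x <= r) = (x' <= r)) -> x = x'.
Proof.
move=> ax ax' H; case: (ltngtP x x') => // lt.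
- by have := H _ (addable_pred ax' (leq_ltn_trans (leq0n _) lt)); lia.
- by have := H _ (addable_pred ax (leq_ltn_trans (leq0n _) lt)); lia.
Qed.

Lemma yam_from_perm s s' r : perm_eq s s' -> yam_from s r = yam_from s' r.
Proof.
elim: r s s' => //= x r IH s s' pe; rewrite (addable_perm _ pe).
by rewrite (IH _ (rcons s' x)) // -!cats1 perm_cat2r.
Qed.

Lemma yam_perm_cat s s' r : perm_eq s s' -> yam s' -> yam (s ++ r) -> yam (s' ++ r).
Proof. by move=> pe ys'; rewrite !yam_cat ys' (yam_from_perm _ pe) => /andP[]. Qed.

(** The hypothesis says that the first letter lies between the other two in reading order. Within
    one row the smaller letter is read first, whence the mix of [<=] and [<]. In [move3_mid2] it is
    the third letter that lies between. *)
Lemma move3_mid0 x y z : (y <= x < z) || (z <= x < y) -> move3 x y z = [:: x; z; y].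
Proof.
by move=> H; rewrite /move3; case: (leqP y x) => ?; case: (leqP z y) => ?;
  case: (leqP z x) => ? //=; exfalso; lia.
Qed.

Lemma move3_mid2 x y z : (y < z <= x) || (x < z <= y) -> move3 x y z = [:: y; x; z].
Proof.
by move=> H; rewrite /move3; case: (leqP y x) => ?; case: (leqP z y) => ?;
  case: (leqP z x) => ? //=; exfalso; lia.
Qed.

Lemma dmove_end s c r : size s = c -> dmove c (s ++ r) = s ++ dmove 0 r.
Proof. by move=> <-; rewrite -[X in dmove X]addn0 dmove_cat. Qed.

(** Emptying the corners in either order leaves prefixes of the same shape, and row [hi.-1] is a
    corner of it. With the third last letter there, a single move exchanges the last two. *)
Lemma two_corners t lo hi : yam t -> removable lo t -> removable hi t -> lo < hi ->
  exists s, [/\ yam (s ++ [:: hi.-1; lo; hi]), yam (s ++ [:: hi.-1; hi; lo])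
    & perm_eq (s ++ [:: hi.-1; lo; hi]) t].
Proof.
move=> yt rlo rhi lt.
have corner a b : a != b -> removable a t -> removable b t ->
    exists2 w, yam (w ++ [:: b; a]) & perm_eq (w ++ [:: b; a]) t.
  move=> ab ra rb; have [u yu pu] := removable_to_end yt ra.
  have rb' : removable b u.
    by apply: (removable_rcons ab yu); rewrite (removable_perm _ pu).
  have yu0 : yam u by move: yu; rewrite yam_rcons => /andP[].
  have [w yw pw] := removable_to_end yu0 rb'.
  have pw' : perm_eq (rcons w b ++ [:: a]) (u ++ [:: a]) by rewrite perm_cat2r.
  exists w; rewrite -cat_rcons.
    by apply: (yam_perm_cat _ yw (s := u)); rewrite ?cats1 // perm_sym.
  by apply: (perm_trans pw'); rewrite cats1.
have [w yw pw] := corner hi lo (negbT (gtn_eqF lt)) rhi rlo.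
have [w' yw' pw'] := corner lo hi (negbT (ltn_eqF lt)) rlo rhi.
have yw0 : yam w by move: yw; rewrite yam_cat => /andP[].
have [s ys ps] := removable_to_end yw0 (removable_between yt rlo rhi lt pw).
have pww' : perm_eq w' (rcons s hi.-1).
  rewrite -(perm_cat2r [:: hi; lo]) (perm_trans pw') // perm_sym.
  apply: perm_trans pw; rewrite -(perm_cat2r [:: lo; hi]) in ps.
  apply: perm_trans ps; rewrite perm_cat2l.
  by apply/permPl/(perm_catC [:: hi] [:: lo]).
exists s; rewrite -!(cat_rcons hi.-1); split.
- by apply: (yam_perm_cat _ ys yw); rewrite perm_sym.
- exact: (yam_perm_cat pww' ys yw').
- by apply: perm_trans pw; rewrite perm_cat2r.
Qed.

(* Two tableaux of one shape whose last letters lie in different corners are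
   linked through tableaux with the last two letters in these corners and the
   third last between them. *)
Lemma yam_connected t t' : yam t -> yam t' -> perm_eq t t' ->
  exists2 cs, all (fun c => c.+2 < size t) cs & run dmove t cs = t'.
Proof.
have [n] := ubnP (size t); elim: n t t' => // n IH t t' lt yt yt' pe.
case/lastP: t lt yt pe => [|u x] lt yt pe.
  by exists [::] => //; apply/esym/perm_nilP; rewrite perm_sym.
case/lastP: t' yt' pe => [|u' x'] yt' pe; first by have := perm_size pe; rewrite size_rcons.
rewrite size_rcons in lt *.
have key (v v' : seq nat) y : yam (rcons v y) -> yam (rcons v' y) ->
    perm_eq (rcons v y) (rcons v' y) -> size v = size u ->
    exists2 cs, all (fun c => c.+2 < (size u).+1) cs & run dmove (rcons v y) cs = rcons v' y.
  rewrite !yam_rcons -!cats1 perm_cat2r => /andP[yv _] /andP[yv' _] pv sv.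
  have [|cs cs1 e] := IH v v' _ yv yv' pv; first by rewrite sv.
  exists cs; last by rewrite run_dmove_cat ?e.
  by apply: sub_all cs1 => c; rewrite sv; apply: leqW.
case: (eqVneq x x') pe => [e|xx'] pe; first by rewrite -e in yt' pe *; apply: key.
have rx' : removable x' (rcons u x) by rewrite (removable_perm _ pe) removable_last.
have [s [q [sq y1 y2 ps]]] : exists s q, [/\ (x' <= q < x) || (x <= q < x'),
    yam (s ++ [:: q; x'; x]), yam (s ++ [:: q; x; x'])
    & perm_eq (s ++ [:: q; x'; x]) (rcons u x)].
  have rx := removable_last yt.
  case: (ltngtP x x') xx' => // lx _.
    have [s [y1 y2 ps]] := two_corners yt rx rx' lx.
    exists s, x'.-1; split => //; first by move: lx; clear; lia.
    apply: perm_trans ps; rewrite perm_cat2l perm_cons.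
    by apply/permPl/(perm_catC [:: x'] [:: x]).
  have [s [y1 y2 ps]] := two_corners yt rx' rx lx.
  by exists s, x.-1; split => //; move: lx; clear; lia.
have ps' : perm_eq (s ++ [:: q; x; x']) (rcons u' x').
  apply: perm_trans pe; apply: perm_trans ps; rewrite perm_cat2l perm_cons.
  by apply/permPl/(perm_catC [:: x] [:: x']).
have su : size u = (size s).+2.
  by apply/eq_add_S; rewrite -(size_rcons u x) -(perm_size ps) size_cat addn3.
have E a b : s ++ [:: q; a; b] = rcons (s ++ [:: q; a]) b by rewrite -cats1 -catA.
have [||||cs1 ok1 e1] := key u (s ++ [:: q; x']) x; rewrite -?E //.
  by rewrite perm_sym.
have [||||cs2 ok2 e2] := key (s ++ [:: q; x]) u' x'; rewrite -?E //.
  by rewrite size_cat su addn2.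
exists (cs1 ++ size s :: cs2); first by rewrite all_cat ok1 /= ok2 su ltnS leqnn.
by rewrite run_cat e1 /= -E (dmove_end _ (erefl _)) /= cats0 move3_mid0 // E.
Qed.

Definition sgt (t : seq nat) (h : nat) : bool := nth 0 t h.+1 <= nth 0 t h.

Lemma sgt_catl s r h : h.+1 < size s -> sgt (s ++ r) h = sgt s h.
Proof. by move=> lt; rewrite /sgt !nth_cat lt (ltnW lt). Qed.

Lemma sgt_end s r c h : size s = c -> sgt (s ++ r) (c + h) = sgt r h.
Proof. by move=> <-; rewrite /sgt -addnS !nth_cat !ltnNge !leq_addr /= !addKn. Qed.

(** Signs along all walks determine a lattice word. By induction they determine the prefix [u]; each
    corner [r] of [u] can be brought to its end by a walk, and the last sign then compares [r] with
    the last letter, so [addable_inj] applies. *)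
Lemma yam_rigid t t' : yam t -> yam t' -> size t = size t' ->
  (forall cs, all (fun c => c.+2 < size t) cs -> forall h, h.+1 < size t ->
     sgt (run dmove t cs) h = sgt (run dmove t' cs) h) -> t = t'.
Proof.
elim/last_ind: t t' => [|u x IH] t'; first by case: t'.
case/lastP: t' => [|u' x'] yt yt'; rewrite !size_rcons // => -[su] H.
have [[yu ax] [yu' ax']] : (yam u /\ addable x u) /\ (yam u' /\ addable x' u').
  by move: yt yt'; rewrite !yam_rcons => /andP[-> ->] /andP[-> ->].
have wk cs : all (fun c => c.+2 < size u) cs -> all (fun c => c.+2 < (size u).+1) cs.
  by apply: sub_all => c /ltnW.
have E : u = u'.
  apply: IH => // cs ok h lt; have := H cs (wk _ ok) h (ltnW lt).
  by rewrite -!cats1 !run_dmove_cat -?su // !sgt_catl ?size_run -?su.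
rewrite -E in ax' H *; congr rcons; apply: (addable_inj ax ax') => r rr.
have [w yw pw] := removable_to_end yu rr; have [cs ok e] := yam_connected yu yw (etrans
  (perm_sym _ _) pw).
have su1 : size u = (size w).+1 by rewrite -(perm_size pw) size_rcons.
have := H cs (wk _ ok) (size w).
rewrite -!cats1 !run_dmove_cat // e su1 leqnn => /(_ isT).
by rewrite !cats1 /sgt !nth_rcons !size_rcons !ltnn !eqxx ltnS leqnn.
Qed.

(** * Graphs with dual equivalence edges *)

Section Reach.
Variables (V : finType) (E : nat -> V -> V).

(** A walk is a list of colours and may pause, since [E c] is to fix the vertices without an edge of
    colour [c]. *)
Definition reach (P : pred nat) (v w : V) : Prop :=
  exists2 cs, all P cs & w = run E v cs.

Lemma reach_refl P v : reach P v v. Proof. by exists [::]. Qed.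

Lemma reach_trans P v w x : reach P v w -> reach P w x -> reach P v x.
Proof.
by move=> [cs ok ->] [cs' ok' ->]; exists (cs ++ cs'); rewrite ?all_cat ?ok ?run_cat.
Qed.

Lemma reach1 (P : pred nat) v c : P c -> reach P v (E c v).
Proof. by move=> Pc; exists [:: c]; rewrite //= Pc. Qed.

Lemma reach_sub (P Q : pred nat) v w : subpred P Q -> reach P v w -> reach Q v w.
Proof. by move=> PQ [cs ok ->]; exists cs => //; apply: sub_all ok. Qed.

Lemma reach_run (P : pred nat) v cs : all P cs -> reach P v (run E v cs).
Proof. by move=> ok; exists cs. Qed.

Lemma reach_sym (P : pred nat) v w : (forall c u, P c -> E c (E c u) = u) ->
  reach P v w -> reach P w v.
Proof.
move=> EK [cs ok ->]; exists (rev cs); first by rewrite all_rev.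
by rewrite (run_revK (P := P)).
Qed.

(** The decidable form of [reach], needed to choose an extremal vertex of a component; the bound [L]
    makes the set of colours finite. *)
Definition reachb (L : nat) (P : pred nat) : rel V :=
  connect [rel v w | [exists c : 'I_L, P c && (E c v == w)]].

Lemma reachP L (P : pred nat) v w : (forall c, P c -> c < L) ->
  reflect (reach P v w) (reachb L P v w).
Proof.
move=> PL; apply: (iffP connectP) => [[p]|[cs]].
  elim: p v => [|u p IH] v /=; first by move=> _ ->; apply: reach_refl.
  move=> /andP[/existsP[c /andP[Pc /eqP <-]] /IH{}IH] /IH.
  exact: reach_trans (reach1 _ Pc).
elim: cs v => [|c cs IH] v /=; first by move=> _ ->; exists [::].
move=> /andP[Pc /IH{}IH] /IH[p pp ->]; exists (E c v :: p) => //=.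
by rewrite pp andbT; apply/existsP; exists (Ordinal (PL c Pc)); rewrite Pc eqxx.
Qed.

Definition reach_bounded (P : pred nat) (v : V) (k : nat) : Prop :=
  forall s : seq V, uniq s -> (forall w, w \in s -> reach P v w) -> size s <= k.

End Reach.

(* The colour c stands for the colour m + 1 + c of the axioms, the sign h for
   sigma_(m + h), and the L letters for m, ..., m + L - 1. Axiom 4 enters only
   through the sizes of components: 3 and 6 (and 16 for Axiom 4+) are the largest
   numbers of standard tableaux of one shape with 4, 5 (and 6) cells. *)
Record dual_graph (V : finType) (E : nat -> V -> V) (sg : V -> nat -> bool) (L : nat) : Prop :=
  DualGraph {
  EK : forall c v, c.+2 < L -> E c (E c v) = v;
  Efix : forall c v, c.+2 < L -> (E c v == v) = (sg v c == sg v c.+1);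
  Eflip : forall c v, c.+2 < L -> E c v != v ->
    sg (E c v) c = ~~ sg v c /\ sg (E c v) c.+1 = ~~ sg v c.+1;
  Efar : forall c v h, c.+2 < L -> h.+1 < L -> (h.+1 < c) || (c.+2 < h) ->
    sg (E c v) h = sg v h;
  Eprev : forall c v, c.+3 < L -> E c.+1 v != v ->
    (sg v c != sg v c.+1) || (sg (E c.+1 v) c != sg (E c.+1 v) c.+1);
  Enext : forall c v, c.+3 < L -> E c v != v ->
    (sg v c.+1 != sg v c.+2) || (sg (E c v) c.+1 != sg (E c v) c.+2);
  Ecomm : forall c c' v, c.+2 < c' -> c'.+2 < L -> E c (E c' v) = E c' (E c v);
  small2 : forall c v, c.+3 < L ->
    reach_bounded E (fun x => c <= x < c + 2) v 3;
  small3 : forall c v, c.+4 < L ->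
    reach_bounded E (fun x => c <= x < c + 3) v 6
}.

(** * Coverings by tableaux and the row of the next letter *)

Section DualGraph.
Variables (V : finType) (E : nat -> V -> V) (sg : V -> nat -> bool) (L : nat).
Hypothesis G : dual_graph E sg L.

Let EK := EK G.

(** Colour [c] moves the letters at places [c], [c.+1], [c.+2], so these are the colours acting
    inside the first [k] letters. *)
Definition lower (k : nat) : pred nat := fun c => c.+2 < k.

Lemma lower_sub k k' : k <= k' -> subpred (lower k) (lower k').
Proof. by move=> le c lt; apply: leq_trans le. Qed.

Lemma reachS k v w : k <= L -> reach E (lower k) v w -> reach E (lower k) w v.
Proof. by move=> kL; apply: reach_sym => c u ck; apply/EK/(leq_trans ck). Qed.

Lemma run_comm c v cs : c.+2 < L -> all (lower c) cs ->
  E c (run E v cs) = run E (E c v) cs.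
Proof.
move=> cL; elim/last_ind: cs => // cs c' IH; rewrite all_rcons !run_rcons => /andP[cc ok].
by rewrite -(Ecomm G) // IH.
Qed.

Lemma sg_run_lower k h v cs : h.+1 < L -> k <= h -> all (lower k) cs ->
  sg (run E v cs) h = sg v h.
Proof.
move=> hL kh; elim/last_ind: cs => // cs c IH; rewrite all_rcons run_rcons => /andP[ck ok].
have cL : c.+2 < L := ltn_trans (leq_trans ck kh) (ltnW hL).
by rewrite (Efar G) ?IH // (leq_trans ck kh) orbT.
Qed.

Lemma Eneq c v : c.+2 < L -> (E c v != v) = (sg v c != sg v c.+1).
Proof. by move=> cL; rewrite (Efix G). Qed.

(* A path of three edges with alternating colours a, b would have too many
   vertices for a class of words on four letters. *)
Lemma double_edge d a b v : d.+3 < L -> d <= a < d + 2 -> d <= b < d + 2 ->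
  E a v != v -> E b v != v -> E b (E a v) != E a v -> E a v = E b v.
Proof.
move=> dL ra rb av bv bav; apply/eqP/negPn/negP => ab.
have aL : a.+2 < L by move: ra dL; clear; lia.
have bL : b.+2 < L by move: rb dL; clear; lia.
suff /(small2 G dL (v := v)) : uniq [:: v; E a v; E b v; E b (E a v)].
  move=> /(_ _)/wrap[] // w; rewrite !inE => /or4P[] /eqP->.
  - exact: reach_refl.
  - exact: reach1.
  - exact: reach1.
  - by apply: reach_trans (reach1 _ _ _); [apply: reach1|].
rewrite /= !inE !negb_or andbT -!(eq_sym v) in av bv ab bav *.
rewrite av bv ab -(inj_eq (can_inj (fun u => EK u bL))) EK // eq_sym ab.
by rewrite eq_sym bav /= (inj_eq (can_inj (fun u => EK u bL))) av.
Qed.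

Record covering (k : nat) (phi : V -> seq nat) : Prop := Cover {
  cover_size : forall v, size (phi v) = k;
  cover_yam : forall v, yam (phi v);
  cover_sg : forall v h, h.+1 < k -> sg v h = sgt (phi v) h;
  cover_E : forall v c, c.+2 < k -> phi (E c v) = dmove c (phi v)
}.

(** A faithful covering maps each component of the colours [lower k] bijectively to the tableaux of
    one shape; surjectivity is [cover_lift]. *)
Definition faithful (k : nat) (phi : V -> seq nat) : Prop :=
  forall v w, reach E (lower k) v w -> phi v = phi w -> v = w.

Lemma cover_run k phi v cs : covering k phi -> all (lower k) cs ->
  phi (run E v cs) = run dmove (phi v) cs.
Proof.
move=> C; elim/last_ind: cs => // cs c IH; rewrite all_rcons !run_rcons => /andP[cL ok].
by rewrite (cover_E C) // IH.
Qed.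

Lemma cover_perm k phi v w : covering k phi -> reach E (lower k) v w ->
  perm_eq (phi v) (phi w).
Proof. by move=> C [cs ok ->]; rewrite (cover_run _ C) // perm_sym perm_run. Qed.

Lemma cover_lift k phi v t : covering k phi -> yam t -> perm_eq (phi v) t ->
  exists2 w, reach E (lower k) v w & phi w = t.
Proof.
move=> C yt pe; have [cs ok e] := yam_connected (cover_yam C v) yt pe.
rewrite (cover_size C) in ok; exists (run E v cs); first exact: reach_run.
by rewrite (cover_run _ C).
Qed.

Section NewLetter.
Variables (j : nat) (phi : V -> seq nat).
Hypotheses (jL : j.+1 < L) (C : covering j.+1 phi) (F : faithful j.+1 phi).
Let linked := reach E (lower j.+1).

Lemma phi_rcons v : exists2 u, size u = j & phi v = rcons u (last 0 (phi v)).
Proof.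
have := cover_size C v; case/lastP: (phi v) => // u x; rewrite size_rcons => -[su].
by exists u; rewrite ?last_rcons.
Qed.

Lemma removable_phi v : removable (last 0 (phi v)) (phi v).
Proof. by have := cover_yam C v; have [u _ ->] := phi_rcons v;
  rewrite last_rcons => /removable_last. Qed.

(** With the last letters in one corner, the remaining letters have the same shape and are joined by
    colours in [lower j]. By faithfulness this walk ends at [w] itself, and its colours are too low
    to change sign [j]. *)
Lemma sg_const v w : linked v w -> last 0 (phi v) = last 0 (phi w) -> sg v j = sg w j.
Proof.
move=> vw e; have [u su eu] := phi_rcons v; have [u' su' eu'] := phi_rcons w.
have pe := cover_perm C vw; have yv := cover_yam C v; have yw := cover_yam C w.
rewrite eu eu' -e -!cats1 perm_cat2r in pe.
rewrite eu yam_rcons in yv; rewrite eu' yam_rcons in yw.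
case/andP: yv => yu _; case/andP: yw => yu' _.
have [cs ok ecs] := yam_connected yu yu' pe; rewrite su in ok.
have ok' : all (lower j.+1) cs by apply: sub_all ok; apply: lower_sub.
rewrite -(sg_run_lower v jL (leqnn j) ok); congr (sg _ j); apply: F.
  by apply: reach_trans vw; exact: reachS (ltnW jL) (reach_run _ _ ok').
by rewrite (cover_run _ C) // eu -cats1 run_dmove_cat ?su // ecs cats1 e -eu'.
Qed.

(** By [sg_const] one may choose representatives joined by an edge that exchanges the two corners.
    Along it sign [c.+1] passes from + to -, so Axiom 3 makes the next sign - at the start or + at
    the end, which is the claim. *)
Lemma sg_mono v w : linked v w -> last 0 (phi v) <= last 0 (phi w) -> sg v j -> sg w j.
Proof.
move=> vw; rewrite leq_eqVlt => /orP[/eqP/(sg_const vw)->//|lt].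
have rw : removable (last 0 (phi w)) (phi v).
  by rewrite (removable_perm _ (cover_perm C vw)) removable_phi.
have [s] := two_corners (cover_yam C v) (removable_phi v) rw lt.
set lo := last 0 _ in lt rw *; set hi := last 0 _ in lt rw * => -[y1 y2 ps].
have ps' : perm_eq (phi v) (s ++ [:: hi.-1; hi; lo]).
  rewrite perm_sym; apply: perm_trans ps; rewrite perm_cat2l perm_cons.
  by apply/permPl/(perm_catC [:: hi] [:: lo]).
have sj : j = (size s).+2.
  by apply/eq_add_S; rewrite -(cover_size C v) (perm_size ps') size_cat addn3.
have [v1 vv1 e1] := cover_lift C y2 ps'.
set c := size s in sj; have cj : c.+2 < j.+1 by rewrite sj.
have e2 : phi (E c v1) = s ++ [:: hi.-1; lo; hi].
  rewrite (cover_E C) // e1 (dmove_end _ (erefl _)) /= cats0 move3_mid0 //.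
  by move: lt; clear; lia.
have vw1 : linked v (E c v1) by apply: reach_trans vv1 (reach1 _ _ _).
rewrite (sg_const vv1); last by rewrite e1 last_cat.
rewrite (sg_const (_ : linked w (E c v1))); last by rewrite e2 last_cat.
  have s1 : sg v1 c.+1.
    by rewrite (cover_sg C) ?sj // e1 -addn1 (sgt_end _ _ (erefl _)) /sgt /= ltnW.
  have s2 : sg (E c v1) c.+1 = false.
    rewrite (cover_sg C) ?sj // e2 -addn1 (sgt_end _ _ (erefl _)) /sgt /=.
    by apply/negbTE; rewrite -ltnNge.
  have cL : c.+3 < L by rewrite -sj.
  have ne : E c v1 != v1 by apply: contraTneq s1 => <-; rewrite s2.
  by have := Enext G cL ne; rewrite s1 s2 -sj; case: (sg v1 j) => //=; case: sg.
by apply: reach_trans vw1; apply: reachS (ltnW jL) vw.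
Qed.

Lemma new_row v : exists z, addable z (phi v) /\
  forall w, linked v w -> sg w j = (z <= last 0 (phi w)).
Proof.
have rP w : reflect (linked v w) (reachb E L (lower j.+1) v w).
  by apply: reachP => c cj; apply: (ltn_trans _ jL); apply: ltn_trans cj.
case: (pickP [pred w | reachb E L (lower j.+1) v w && ~~ sg w j]) => [w0 w0P|none].
  case: (arg_maxnP (fun w => last 0 (phi w)) w0P) => w1 /= /andP[/rP vw1 s1] max1.
  (* [w1] has the highest corner among the vertices of negative sign. The threshold is the row just
     above it, addable because that corner is removable; without negative signs the threshold is row
     0. *)
  exists (last 0 (phi w1)).+1; split.
    rewrite (addable_perm _ (cover_perm C vw1)) /addable /=.
    exact: removable_phi.
  move=> w vw; apply/idP/idP => [sw|]; last first.
    by apply: contraTT => sw; rewrite -leqNgt max1 //= sw andbT; apply/rP.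
  rewrite ltnNge; apply: contra s1 => le; apply: sg_mono le sw.
  exact: reach_trans (reachS (ltnW jL) vw) vw1.
exists 0; split=> // w vw; rewrite leq0n; apply/negPn/negP => sw.
by have := none w; rewrite /= sw andbT => /rP; apply.
Qed.

(** This is a covering with one more letter, except for compatibility with the new top colour. The
    added row is constant on each component of the lower colours because every corner occurs there
    as the row of the last letter, and the signs at these corners determine the row by
    [addable_inj]. *)
Lemma extend : exists psi : V -> seq nat,
  [/\ forall v, size (psi v) = j.+2,
      forall v, yam (psi v),
      forall v h, h.+1 < j.+2 -> sg v h = sgt (psi v) h,
      forall v c, c.+2 < j.+1 -> psi (E c v) = dmove c (psi v)
    & forall v w, linked v w -> psi v = psi w -> v = w].
Proof.
have [z zP] := fin_all_exists new_row.
have az v : addable (z v) (phi v) by case: (zP v).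
have sz v : sg v j = (z v <= last 0 (phi v)) by case: (zP v) => _; apply; apply: reach_refl.
have zE v w : linked v w -> z v = z w.
  move=> vw; apply: (addable_inj (az v)).
    by rewrite (addable_perm _ (cover_perm C vw)).
  move=> r rr; have [u yu pu] := removable_to_end (cover_yam C v) rr.
  have [x vx ex] := cover_lift C yu (etrans (perm_sym _ _) pu).
  have [_ /(_ x vx)] := zP v; have [_ /(_ x)] := zP w.
  rewrite ex last_rcons => <- //; apply: reach_trans vx.
  exact: reachS (ltnW jL) vw.
exists (fun v => rcons (phi v) (z v)); split=> [v|v|v h|v c cj|v w vw /rcons_inj[e _]].
- by rewrite size_rcons (cover_size C).
- by rewrite yam_rcons (cover_yam C) az.
- rewrite ltnS ltnS leq_eqVlt => /orP[/eqP->|lt].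
    rewrite sz /sgt !nth_rcons !(cover_size C) ltnn eqxx ltnSn.
    by rewrite -nth_last (cover_size C).
  by rewrite (cover_sg C) // -cats1 sgt_catl // (cover_size C).
- rewrite -(zE v (E c v)); last exact: reach1.
  by rewrite (cover_E C) // -!cats1 dmove_catl // (cover_size C).
- exact: F.
Qed.

End NewLetter.
End DualGraph.

(** * The edges of top colour *)

Lemma cat_inj (s s' r r' : seq nat) : size s = size s' -> s ++ r = s' ++ r' -> s = s' /\ r = r'.
Proof. by move=> e /eqP; rewrite eqseq_cat // => /andP[/eqP-> /eqP->]. Qed.

Lemma cat3_inj (s s' : seq nat) x y z x' y' z' :
  s ++ [:: x; y; z] = s' ++ [:: x'; y'; z'] -> [/\ s = s', x = x', y = y' & z = z'].
Proof.
move=> e; have /(congr1 size) := e; rewrite !size_cat => /addIn es.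
by have [-> [-> -> ->]] := cat_inj es e.
Qed.

(** The cell of [y] supports that of [z] only if [y] is [z.-1]; then [x] lies in the same row and
    already gives the room for [z]. *)
Lemma yam_between s x y z : yam (s ++ [:: x; y; z]) -> (y <= x < z) || (z <= x < y) ->
  addable z (rcons s x).
Proof.
rewrite yam_cat /= => /andP[ys /and4P[_ _ az _]] xyz.
move: az; have := @yam_cnt z.-1 s ys; rewrite /addable !cnt_rcons.
by case: z xyz => //= z; blia.
Qed.

(** The delicate case is [x = y.-1]. Then [z = y], and since two cells fit in row [y] above [s] and
    [x], one of them fits above [s] alone. *)
Lemma yam_middle s x y z : yam (s ++ [:: x; y; z]) -> (y < z <= x) || (x < z <= y) ->
  removable (maxn x y).-1 s.
Proof.
rewrite yam_cat /= => /andP[ys /and4P[ax ay az _]] /orP[]/andP[lt le].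
  rewrite (maxn_idPl (ltnW (leq_trans lt le))).
  exact: addable_pred ax (leq_trans (leq_ltn_trans (leq0n _) lt) le).
rewrite (maxn_idPr (ltnW (leq_trans lt le))).
move: ay az; rewrite /addable /removable !cnt_rcons.
by case: y lt le => [|y] /=; [case: z|case: z => //= z; blia].
Qed.

Section TopColour.
Variables (V : finType) (E : nat -> V -> V) (sg : V -> nat -> bool) (L : nat).
Hypothesis G : dual_graph E sg L.
Variables (c : nat) (psi : V -> seq nat).
Hypotheses (cL : c.+2 < L) (size_psi : forall v, size (psi v) = c.+3)
  (yam_psi : forall v, yam (psi v))
  (sg_psi : forall v h, h.+1 < c.+3 -> sg v h = sgt (psi v) h)
  (psi_E : forall v d, d.+2 < c.+2 -> psi (E d v) = dmove d (psi v)).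

Let EK := EK G.
Let c_le : c <= c.+2. Proof. exact: leqW. Qed.

Lemma psi_end v : exists s x y z, size s = c /\ psi v = s ++ [:: x; y; z].
Proof.
have := size_psi v; rewrite -[psi v](cat_take_drop c) size_cat size_takel ?size_psi ?leqW //.
move/eqP; rewrite -(addn3 c) eqn_add2l; case: (drop c _) => [|x [|y [|z []]]] // _.
by exists (take c (psi v)), x, y, z; rewrite size_takel // size_psi ?leqW.
Qed.

Lemma size_start v s x y z : psi v = s ++ [:: x; y; z] -> size s = c.
Proof.
by move=> e; apply/eqP; have /eqP := size_psi v; rewrite e size_cat -addn3 eqn_add2r.
Qed.

Lemma psi_run v cs : all (lower c.+2) cs -> psi (run E v cs) = run dmove (psi v) cs.
Proof.
elim/last_ind: cs => // cs d IH; rewrite all_rcons !run_rcons => /andP[dc ok].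
by rewrite psi_E // IH.
Qed.

Lemma psi_run_low v s r cs k : psi v = s ++ r -> k <= c.+2 -> k <= size s ->
  all (lower k) cs -> psi (run E v cs) = run dmove s cs ++ r.
Proof.
move=> e kc ks ok; rewrite psi_run; last by apply: sub_all ok; apply: lower_sub.
by rewrite e run_dmove_cat //; apply: sub_all ok; apply: lower_sub.
Qed.

Lemma psi_lift v s r t : psi v = s ++ r -> size s <= c.+2 -> yam t -> perm_eq s t ->
  exists2 cs, all (lower (size s)) cs & psi (run E v cs) = t ++ r.
Proof.
move=> e le yt pe; have := yam_psi v; rewrite e yam_cat => /andP[ys _].
have [cs ok ecs] := yam_connected ys yt pe; exists cs => //.
by rewrite (psi_run_low e le (leqnn _) ok) ecs.
Qed.

Lemma sg_end v s x y z : psi v = s ++ [:: x; y; z] ->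
  sg v c = (y <= x) /\ sg v c.+1 = (z <= y).
Proof.
move=> e; have sc := size_start e; rewrite !sg_psi // e -[in c.+1]addn1 -[X in sgt _ X]addn0.
by rewrite !(sgt_end _ _ sc).
Qed.

Lemma sg_before v s x y z u d : psi v = rcons s u ++ [:: x; y; z] -> c = d.+1 ->
  sg v d = (x <= u).
Proof.
move=> e cd; have := size_start e; rewrite size_rcons cd => -[sd].
rewrite sg_psi; last by rewrite cd; clear; lia.
by rewrite e cat_rcons -[X in sgt _ X]addn0 (sgt_end _ _ sd).
Qed.

Lemma run_top v cs : all (lower c) cs -> E c (run E v cs) = run E (E c v) cs.
Proof. by move=> ok; apply: (run_comm G). Qed.

(** Walks among the first [c] letters commute with the top edge, which does not change the signs
    between these letters. So both ends show the same signs along all such walks, and [yam_rigid]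
    applies. *)
Lemma same_start v s x y z s' x' y' z' : psi v = s ++ [:: x; y; z] ->
  psi (E c v) = s' ++ [:: x'; y'; z'] -> s = s'.
Proof.
move=> e e'; have [sc sc'] := (size_start e, size_start e').
have [ys ys'] : yam s /\ yam s'.
  by have := yam_psi v; have := yam_psi (E c v); rewrite e e' !yam_cat => /andP[-> _]
    /andP[-> _].
apply: yam_rigid; rewrite ?sc ?sc' // => cs ok h hc.
have R u t r : psi u = t ++ r -> size t = c -> sg (run E u cs) h = sgt (run dmove t cs) h.
  move=> eu st; rewrite sg_psi; last by move: hc; clear; lia.
  by rewrite (psi_run_low eu _ _ ok) ?st // sgt_catl // size_run st.
rewrite -(R _ _ _ e sc) -(R _ _ _ e' sc') -run_top // (Efar G) ?hc //.
by apply: ltn_trans cL; rewrite ltnW // ltnW.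
Qed.

Lemma E_neq v s x y z : psi v = s ++ [:: x; y; z] ->
  (E c v != v) = ((y <= x) != (z <= y)).
Proof. by move=> /sg_end[sx sy]; rewrite (Eneq G) // sx sy. Qed.

Lemma E_signs v s x y z s' x' y' z' : psi v = s ++ [:: x; y; z] ->
  psi (E c v) = s' ++ [:: x'; y'; z'] -> (y <= x) != (z <= y) ->
  (y' <= x') = ~~ (y <= x) /\ (z' <= y') = ~~ (z <= y).
Proof.
move=> e e'; rewrite -(E_neq e) => /(Eflip G cL).
by have [-> ->] := sg_end e; have [-> ->] := sg_end e'.
Qed.

(* With the new letter between the two before it, fill the row just below the
   higher of these with the preceding letter: then the two top colours form a
   double edge. *)
Lemma new_letter_between v s x y z : psi v = s ++ [:: x; y; z] ->
  (y < z <= x) || (x < z <= y) ->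
  psi (E c v) = dmove c (psi v) /\ reach E (lower c.+2) v (E c v).
Proof.
move=> e xyz; have sc := size_start e; have yv : yam (s ++ [:: x; y; z]) by rewrite -e.
have ru := yam_middle yv xyz; set u := _.-1 in ru.
have ys : yam s by move: yv; rewrite yam_cat => /andP[].
have [s1 y1 p1] := removable_to_end ys ru.
have [cs ok e1] : exists2 cs, all (lower c) cs &
    psi (run E v cs) = rcons s1 u ++ [:: x; y; z].
  by rewrite -[in lower c]sc; apply: (psi_lift e); rewrite // ?sc // perm_sym.
set v1 := run E v cs in e1.
have [d cd] : exists d, c = d.+1 by exists (size s1); rewrite -sc -(perm_size p1) size_rcons.
have sd : size s1 = d by apply/eq_add_S; rewrite -cd -sc -(perm_size p1) size_rcons.
have dc : d.+2 < c.+2 by rewrite cd.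
have e2 : psi (E d v1) = rcons s1 u ++ [:: y; x; z].
  rewrite psi_E // e1 cat_rcons (dmove_end _ sd) /= move3_mid0 ?cat_rcons //.
  by move: xyz; rewrite /u; clear; lia.
have n1 : E c v1 != v1 by rewrite (E_neq e1); move: xyz; clear; lia.
have n2 : E c (E d v1) != E d v1 by rewrite (E_neq e2); move: xyz; clear; lia.
have n3 : E d v1 != v1.
  apply/eqP => /(congr1 psi); rewrite e1 e2 => /cat3_inj[_ yx _ _].
  by move: xyz; rewrite yx; clear; lia.
have dbl : E d v1 = E c v1 by apply: (double_edge (d := d) G) => //; move: cL cd; clear; lia.
have e3 : run E (E c v) cs = E d v1 by rewrite dbl run_top.
have [s' [x' [y' [z' [sc' e']]]]] := psi_end (E c v).
have ss := same_start e e'; subst s'.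
have := psi_run_low e' c_le _ ok; rewrite sc => /(_ (leqnn c)).
rewrite e3 e2 => /cat3_inj[_ ey ex ez]; split.
  by rewrite e' e -ey -ex -ez (dmove_end _ sc) /= move3_mid2.
apply: (@reach_trans _ _ _ _ v1).
  by apply: reach_run; apply: sub_all ok; apply: lower_sub.
apply: (@reach_trans _ _ _ _ (E d v1)); first exact: reach1.
rewrite -e3; apply: (reachS G (ltnW cL)); apply: reach_run.
by apply: sub_all ok; apply: lower_sub.
Qed.

(** To get [x = x'] it suffices to compare both with each corner [r] of [s]. Bring [r] to the end of
    [s]; sign [d] at the two ends of the top edge is then the comparison of [r] with [x] and with
    [x']. Axiom 3 excludes [x <= r < x'], and a double edge excludes [x' <= r < x]. *)
Lemma third_fixed v s x y z : psi v = s ++ [:: x; y; z] -> y <= x < z ->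
  exists y' z', psi (E c v) = s ++ [:: x; y'; z'] /\ z' <= x < y'.
Proof.
move=> e xyz; have sc := size_start e.
have [s' [x' [y' [z' [sc' e']]]]] := psi_end (E c v).
have ss := same_start e e'; subst s'; exists y', z'.
have [|g1 g2] := E_signs e e'; first by move: xyz; clear; lia.
have zx' : z' <= x'.
  rewrite leqNgt; apply/negP => xz'.
  have [|+ _] := new_letter_between e'; first by move: g1 g2 xyz xz'; clear; lia.
  rewrite EK // e e' (dmove_end _ sc) /= move3_mid2; last first.
    by move: g1 g2 xyz xz'; clear; lia.
  by move=> /cat3_inj[_ ex _ ez]; move: g1 g2 xyz xz'; rewrite ex ez; clear; lia.
suff ex : x = x' by subst x'; split=> //; move: g1 xyz zx'; clear; lia.
have [yv yw] := (yam_psi v, yam_psi (E c v)); rewrite e e' !yam_cat /= in yv yw.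
case/and5P: yv => ys ax _ _ _; case/and5P: yw => _ ax' _ _ _.
apply: (addable_inj ax ax') => r rr; have [s1 y1 p1] := removable_to_end ys rr.
have [cs ok e1] : exists2 cs, all (lower c) cs &
    psi (run E v cs) = rcons s1 r ++ [:: x; y; z].
  by rewrite -[in lower c]sc; apply: (psi_lift e); rewrite // ?sc // perm_sym.
have [d cd] : exists d, c = d.+1 by exists (size s1); rewrite -sc -(perm_size p1) size_rcons.
have sd : size s1 = d by apply/eq_add_S; rewrite -cd -sc -(perm_size p1) size_rcons.
have dc : d.+2 < c.+2 by rewrite cd.
set v1 := run E v cs in e1.
have e2 : psi (E c v1) = rcons s1 r ++ [:: x'; y'; z'].
  rewrite run_top // (psi_run_low e' _ _ ok) ?sc //.
  congr (_ ++ _); have := psi_run_low e c_le _ ok; rewrite sc => /(_ (leqnn c)).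
  by rewrite -/v1 e1 => /cat3_inj[].
have [[h1 _] [h2 _]] := (sg_end e1, sg_end e2).
have [k1 k2] := (sg_before e1 cd, sg_before e2 cd).
have n1 : E c v1 != v1 by rewrite (E_neq e1); move: xyz; clear; lia.
have dL : d.+3 < L by rewrite -cd.
have := Eprev G dL (v := v1); rewrite -cd => /(_ n1).
rewrite h1 h2 k1 k2; case: (leqP x r) => xr /=.
  by move: g1 xyz; clear; case: (x' <= r); case: (y' <= x') => //; lia.
case: (leqP x' r) => // xr' _; exfalso.
have dL2 : d.+2 < L by rewrite -cd ltnW.
(* The [d]-edge permutes [r], [x], [y] and keeps [z]. Hence [z' = z] and [y'] is one of [r], [x],
   [y], all less than [z], against [z' <= x' < y']. *)
have dbl : E c v1 = E d v1.
  apply: (double_edge (d := d) G) => //; try by rewrite ?cd; clear; lia.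
    by rewrite (Eneq G) // -cd h1 k1; move: xyz xr; clear; lia.
  by rewrite (Eneq G) // -cd h2 k2 xr' g1; move: xyz; clear; lia.
have : psi (E d v1) = rcons s1 r ++ [:: x'; y'; z'] by rewrite -dbl.
rewrite psi_E // e1 !cat_rcons (dmove_end _ sd) => /(cat_inj (erefl _))[_] /=.
move: (perm_mem (perm_move3 r x y) y') (perm_size (perm_move3 r x y)).
case: (move3 r x y) => [|a1 [|a2 [|a3 []]]] //= pm _ [_ _ ey ez].
move: pm; rewrite !inE ey eqxx !orbT.
by move: xr xyz zx' g1; rewrite ez; clear; lia.
Qed.

Definition between3 y x z := (y <= x < z) || (z <= x < y).

(** The second orientation reduces to the first, read from the other end of the edge. *)
Lemma third_between v s x y z : psi v = s ++ [:: x; y; z] -> between3 y x z ->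
  exists y' z', [/\ psi (E c v) = s ++ [:: x; y'; z'],
    y <= x < z -> z' <= x < y' & z <= x < y -> y' <= x < z'].
Proof.
move=> e /orP[xyz|xyz].
  have [y' [z' [e' h]]] := third_fixed e xyz; exists y', z'.
  by split=> //; move: xyz; clear; lia.
have sc := size_start e.
have [s' [x' [y' [z' [sc' e']]]]] := psi_end (E c v).
have ss := same_start e e'; subst s'; exists y', z'.
have [|g1 g2] := E_signs e e'; first by move: xyz; clear; lia.
case: (leqP z' x') => zx'.
  have [|+ _] := new_letter_between e'; first by move: g1 g2 xyz zx'; clear; lia.
  rewrite EK // e e' (dmove_end _ sc) /= move3_mid2; last first.
    by move: g1 g2 xyz zx'; clear; lia.
  by move=> /cat3_inj[_ ex _ ez]; move: g1 g2 xyz zx'; rewrite ex ez; clear; lia.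
have [|y1 [z1 [+ h]]] := third_fixed e'; first by move: g1 xyz zx'; clear; lia.
rewrite EK // e => /cat3_inj[_ ex _ _]; rewrite -ex in e' zx' g1.
by split=> //; move: g1 xyz zx'; clear; lia.
Qed.

(* Otherwise the component would have seven vertices, more than any class of
   words on five letters. *)
Lemma square_base d v s p q x y z : c = d.+2 -> psi v = s ++ [:: p; q; x; y; z] ->
  [&& q <= p < x, y <= q & x < z] || [&& x <= p < q, z <= x & q < y] ->
  E c (E d v) = E d (E c v).
Proof.
move=> cd e ord; have sd : size s = d.
  by apply/eqP; have /eqP := size_psi v; rewrite e size_cat cd -[_.+3]/(5 + d) addnC eqn_add2l.
have [dc mc] : d.+2 < c.+2 /\ d.+3 < c.+2 by rewrite cd.
have sgs u a b1 b2 b3 b4 : psi u = s ++ [:: a; b1; b2; b3; b4] ->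
    [:: sg u d; sg u d.+1; sg u c] = [:: b1 <= a; b2 <= b1; b3 <= b2].
  move=> eu; rewrite !sg_psi; try by rewrite cd; clear; lia.
  have S k r : sgt (s ++ r) (d + k) = sgt r k by exact: sgt_end.
  by rewrite eu cd -[d.+2]addn2 -[d.+1]addn1 -{1}[d]addn0 !S.
have e1 : psi (E d v) = s ++ [:: p; x; q; y; z].
  rewrite psi_E // e (dmove_end _ sd) /= move3_mid0 //.
  by move: ord; clear; lia.
have splice a b1 b2 b3 b4 : s ++ [:: a; b1; b2; b3; b4] = (s ++ [:: a; b1]) ++ [:: b2; b3; b4].
  by rewrite -catA.
have [||y1 [z1 [e2 le1 le2]]] := @third_between v (s ++ [:: p; q]) x y z.
- by rewrite e splice.
- by move: ord; rewrite /between3; clear; lia.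
have [||y2 [z2 [e3 le3 le4]]] := @third_between (E d v) (s ++ [:: p; x]) q y z.
- by rewrite e1 splice.
- by move: ord; rewrite /between3; clear; lia.
rewrite -splice in e2; rewrite -splice in e3.
have e4 : psi (E d (E c v)) = s ++ [:: p; x; q; y1; z1].
  rewrite psi_E // e2 (dmove_end _ sd) /= move3_mid0 //.
  by move: ord; clear; lia.
have sd1 : size (s ++ [:: p]) = d.+1 by rewrite size_cat sd addn1.
have e5 : psi (E d.+1 v) = s ++ [:: p; q; y; x; z].
  rewrite psi_E // e -cat_rcons -cats1 (dmove_end _ sd1) /= move3_mid0 -?catA //.
  by move: ord; clear; lia.
have e6 : psi (E d.+1 (E d (E c v))) = s ++ [:: p; x; y1; q; z1].
  rewrite psi_E // e4 -cat_rcons -cats1 (dmove_end _ sd1) /= move3_mid0 -?catA //.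
  by move: ord le1 le2; clear; lia.
apply/eqP/negPn/negP => ne.
(* Three signs separate the six vertices of [l]. The seventh, [E c (E d v)], shares its signs only
   with [E d (E c v)], from which it differs by assumption. *)
pose code u := [:: sg u d; sg u d.+1; sg u c]; pose o := q <= p.
have k1 : code v = [:: o; ~~ o; o].
  by rewrite /code (sgs _ _ _ _ _ _ e); congr [:: _; _; _]; move: ord; rewrite /o; clear; lia.
have k2 : code (E d v) = [:: ~~ o; o; o].
  by rewrite /code (sgs _ _ _ _ _ _ e1); congr [:: _; _; _]; move: ord; rewrite /o; clear; lia.
have k3 : code (E c v) = [:: o; ~~ o; ~~ o].
  by rewrite /code (sgs _ _ _ _ _ _ e2); congr [:: _; _; _];
     move: ord le1 le2; rewrite /o; clear; lia.
have k4 : code (E d (E c v)) = [:: ~~ o; o; ~~ o].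
  by rewrite /code (sgs _ _ _ _ _ _ e4); congr [:: _; _; _];
     move: ord le1 le2; rewrite /o; clear; lia.
have k5 : code (E c (E d v)) = [:: ~~ o; o; ~~ o].
  by rewrite /code (sgs _ _ _ _ _ _ e3); congr [:: _; _; _];
     move: ord le3 le4; rewrite /o; clear; lia.
have k6 : code (E d.+1 v) = [:: o; o; ~~ o].
  by rewrite /code (sgs _ _ _ _ _ _ e5); congr [:: _; _; _]; move: ord; rewrite /o; clear; lia.
have k7 : code (E d.+1 (E d (E c v))) = [:: ~~ o; ~~ o; o].
  by rewrite /code (sgs _ _ _ _ _ _ e6); congr [:: _; _; _];
     move: ord le1 le2; rewrite /o; clear; lia.
pose l := [:: v; E d v; E c v; E d (E c v); E d.+1 v; E d.+1 (E d (E c v))].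
have dL : d.+4 < L by rewrite -cd.
suff ul : uniq (E c (E d v) :: l).
  have /(_ _)/wrap[|//] := small3 G dL (v := v) ul.
  have R a u : d <= a < d + 3 -> reach E (fun b => d <= b < d + 3) v u ->
      reach E (fun b => d <= b < d + 3) v (E a u).
    by move=> ra vu; apply: reach_trans vu (reach1 _ _ _).
  have [rd rc rm] : [/\ d <= d < d + 3, d <= c < d + 3 & d <= d.+1 < d + 3].
    by rewrite cd; split; clear; lia.
  move=> w; rewrite !inE.
  by do !case/orP; move=> /eqP->; do ?apply: (R) => //; apply: reach_refl.
rewrite cons_uniq; apply/andP; split; last first.
  by apply: (map_uniq (f := code)); rewrite /l /= k1 k2 k3 k4 k6 k7; case: (o).
have nk u w : code u != code w -> u != w by apply: contra_neq => ->.
rewrite !inE !negb_or ne !nk // k5 ?k1 ?k2 ?k3 ?k6 ?k7; case: (o) => //.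
Qed.

(** To put [q] in place of [x], rearrange the first [c] letters until they end in [p], [q] with [p]
    between [q] and [x], then exchange [q] and [x] by colour [c - 2]. The rearrangement commutes
    with the top edge by Axiom 5, the exchange by [square_base]. *)
Lemma square v s x y z q : psi v = s ++ [:: x; y; z] -> removable q (rcons s x) ->
  (y <= x < z) && (y <= q < z) || (z <= x < y) && (z <= q < y) ->
  exists cs s1, [/\ all (lower c.+1) cs, psi (run E v cs) = s1 ++ [:: q; y; z]
    & E c (run E v cs) = run E (E c v) cs].
Proof.
move=> e rq ord; have sc := size_start e.
case: (eqVneq q x) => [->|qx]; first by exists [::], s.
have yx : yam (rcons s x).
  by have := yam_psi v; rewrite e -cat_rcons yam_cat => /andP[].
have rx := removable_last yx.
have [s1 [p [ord1 y1 ps]]] : exists s1 p, [/\ (q <= p < x) || (x <= p < q),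
    yam (s1 ++ [:: p; q]) & perm_eq (s1 ++ [:: p; q]) s].
  case: (ltngtP q x) qx => // lt _.
    have [s1 [y1 _ p1]] := two_corners yx rq rx lt; exists s1, x.-1; split.
    - by move: lt; clear; lia.
    - by move: y1; rewrite -[_ ++ _]/(s1 ++ [:: x.-1; q] ++ [:: x]) catA yam_cat => /andP[].
    - by rewrite -(perm_cat2r [:: x]) -catA (cats1 s).
  have [s1 [y1 y2 p1]] := two_corners yx rx rq lt; exists s1, q.-1; split.
  - by move: lt; clear; lia.
  - by move: y2; rewrite -[_ ++ _]/(s1 ++ [:: q.-1; q] ++ [:: x]) catA yam_cat => /andP[].
  - rewrite -(perm_cat2r [:: x]) -catA (cats1 s); apply: perm_trans p1.
    by rewrite perm_cat2l perm_cons; apply/permPl/(perm_catC [:: q] [:: x]).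
pose d := size s1; have cd : c = d.+2 by rewrite -sc -(perm_size ps) size_cat addn2.
have [cs ok e1] : exists2 cs, all (lower c) cs &
    psi (run E v cs) = (s1 ++ [:: p; q]) ++ [:: x; y; z].
  by rewrite -[in lower c]sc; apply: (psi_lift e); rewrite // ?sc // perm_sym.
rewrite -catA /= in e1; set v1 := run E v cs in e1.
have dc : d.+2 < c.+2 by rewrite cd.
have e2 : psi (E d v1) = s1 ++ [:: p; x; q; y; z].
  rewrite psi_E // e1 (dmove_end _ (erefl _)) /= move3_mid0 //.
exists (rcons cs d), (s1 ++ [:: p; x]); rewrite !run_rcons; split.
- rewrite all_rcons {1}/lower {1}cd ltnSn; apply: sub_all ok; exact: lower_sub.
- by rewrite e2 -catA.
rewrite -(run_top _ ok) -/v1.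
have dL : d.+2 < L by rewrite -cd; apply: ltnW (ltnW cL).
(* [square_base] covers half of the orders of the letters; in the others the same square is started
   from [E d v1]. *)
have [b|b] : [&& q <= p < x, y <= q & x < z] || [&& x <= p < q, z <= x & q < y] \/
    [&& x <= p < q, y <= x & q < z] || [&& q <= p < x, z <= q & x < y].
- by move: ord ord1; clear; lia.
- exact: square_base cd e1 b.
- have := square_base cd e2 b.
  by rewrite EK // => ->; rewrite EK.
Qed.

(** The far side of the square carries the same [y'] and [z'] as the given edge, and [third_between]
    at its near side places [q] between them. *)
Lemma interval v s x y z y' z' q : psi v = s ++ [:: x; y; z] ->
  psi (E c v) = s ++ [:: x; y'; z'] -> removable q (rcons s x) ->
  (y <= x < z) && (y <= q < z) || (z <= x < y) && (z <= q < y) ->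
  (y <= q < z) && (z' <= q < y') || (z <= q < y) && (y' <= q < z').
Proof.
move=> e e' rq ord; have [cs [s1 [ok e1 comm]]] := square e rq ord.
have [|y1 [z1 [e2 le1 le2]]] := third_between e1; first by move: ord; rewrite /between3;
  clear; lia.
have [sc s1c] := (size_start e, size_start e1); rewrite -cat_rcons in e'.
have := psi_run_low e' (leqnSn _) _ ok; rewrite -comm e2 size_rcons sc leqnn -cat_rcons.
move=> /(_ isT)/cat_inj; rewrite size_run !size_rcons s1c sc => /(_ erefl)[_ [ey ez]].
by move: le1 le2 ord; rewrite ey ez; clear; lia.
Qed.

Lemma psi_top v : psi (E c v) = dmove c (psi v).
Proof.
suff main u s x y z : psi u = s ++ [:: x; y; z] -> y <= x < z -> psi (E c u) = dmove c (psi u).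
  have [s [x [y [z [sc e]]]]] := psi_end v.
  case: (boolP ((y <= x) == (z <= y))) => [fix_v|adm].
    have /eqP-> : E c v == v by apply/negPn; rewrite (E_neq e) fix_v.
    by rewrite e (dmove_end _ sc) /= /move3 fix_v.
  case: (boolP ((y < z <= x) || (x < z <= y))) => [/(new_letter_between e)[]//|nm].
  case: (boolP (y <= x < z)) => [|nxyz]; first exact: main e.
  have xyz : z <= x < y by move: adm nm nxyz; clear; lia.
  have [|y' [z' [e' _ /(_ xyz)]]] := third_between e; first by rewrite /between3 xyz orbT.
  by move/(main _ _ _ _ _ e'); rewrite EK // => ->; rewrite dmoveK.
move=> e xyz; have sc := size_start e; have [y' [z' [e' xyz']]] := third_fixed e xyz.
have [yv yw] := (yam_psi u, yam_psi (E c u)); rewrite e e' in yv yw.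
have az : addable z (rcons s x) by apply: yam_between yv _; rewrite xyz.
have az' : addable z' (rcons s x) by apply: yam_between yw _; rewrite xyz' orbT.
have [ay ay'] : addable y (rcons s x) /\ addable y' (rcons s x).
  by move: yv yw; rewrite !yam_cat /= => /andP[_ /and4P[_ -> _ _]] /andP[_ /and4P[_ -> _ _]].
(* The intervals from [y] to [z] and from [z'] to [y'] contain the same corners. Their ends are
   addable rows, each positive one just above a corner, so the ends coincide. *)
have I q : removable q (rcons s x) -> (y <= q < z) = (z' <= q < y').
  move=> rq; apply/idP/idP => h.
    by have := interval e e' rq; move: h xyz; clear; lia.
  have e0 : psi (E c (E c u)) = s ++ [:: x; y; z] by rewrite EK.
  by have := interval e' e0 rq; move: h xyz xyz'; clear; lia.
have ezy : z = y'.
  case: (ltngtP z y') => // lt.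
    by have := I _ (addable_pred ay' _); move: lt xyz xyz'; clear; lia.
  by have := I _ (addable_pred az _); move: lt xyz xyz'; clear; lia.
have eyz : y = z'.
  case: (ltngtP y z') => // lt.
    by have := I _ (addable_pred az' _); move: lt xyz xyz'; clear; lia.
  by have := I _ (addable_pred ay _); move: lt xyz xyz'; clear; lia.
rewrite e' e (dmove_end _ sc) /= cats0 -ezy -eyz move3_mid0 //.
by rewrite xyz.
Qed.

Lemma cover_top : covering E sg c.+3 psi.
Proof.
split=> // v d; rewrite !ltnS leq_eqVlt => /orP[/eqP[->]|lt]; first exact: psi_top.
exact: psi_E.
Qed.

End TopColour.

(** * Faithfulness of the labelling *)

Lemma dmove_map (f : nat -> nat) (p : seq nat) c :
  pairwise (fun x y => (f y <= f x) == (y <= x)) p -> dmove c (map f p) = map f (dmove c p).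
Proof.
elim: c p => [|c IH] [|x p] //=; last by move=> /andP[_ /IH->].
case: p => [|y [|z p]] //= /andP[/and3P[/eqP yx /eqP zx _] /andP[/andP[/eqP zy _] _]].
by rewrite /move3 yx zx zy; case: ifP => // _; case: ifP.
Qed.

Lemma uniq_map_inj (T : eqType) (U : eqType) (f : T -> U) (s : seq T) :
  uniq (map f s) -> {in s &, injective f}.
Proof.
move=> us x y xs ys e; rewrite -(nth_index x xs) -(nth_index x ys); congr nth.
apply/eqP; rewrite -(nth_uniq (f x) _ _ us) ?size_map ?index_mem //.
by rewrite !(nth_map x) ?index_mem // !nth_index // e.
Qed.

(** This peels off a staircase by diagonals: the three given corners, then [q] and [p] between
    neighbouring ones, then [r] between these two. It is the pattern of the shape (3,2,1), possibly
    with longer gaps between the cells. *)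
Lemma three_corners t r1 r2 r3 : yam t -> removable r1 t -> removable r2 t ->
  removable r3 t -> r1 < r2 < r3 ->
  exists s p q r, [/\ yam (s ++ [:: r; q; p; r1; r2; r3]),
    perm_eq (s ++ [:: r; q; p; r1; r2; r3]) t
    & (r1 <= q < r2) && (r2 <= p < r3) && (q <= r < p)].
Proof.
move=> yt h1 h2 h3 /andP[lt12 lt23].
have lt13 := ltn_trans lt12 lt23.
have [u3 y3 p3] := removable_to_end yt h3.
have rem a b w : yam (rcons w a) -> removable b (rcons w a) -> a != b -> removable b w.
  by move=> yw rb ab; apply: removable_rcons ab yw rb.
have yp a w : yam (rcons w a) -> yam w by rewrite yam_rcons => /andP[].
have h2' : removable r2 u3 by apply: rem y3 _ _; rewrite ?(removable_perm _ p3) ?gtn_eqF.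
have h1' : removable r1 u3 by apply: rem y3 _ _; rewrite ?(removable_perm _ p3) ?gtn_eqF.
have [u2 y2 p2] := removable_to_end (yp _ _ y3) h2'.
have h1'' : removable r1 u2 by apply: rem y2 _ _; rewrite ?(removable_perm _ p2) ?gtn_eqF.
have [u1 y1 p1] := removable_to_end (yp _ _ y2) h1''.
have p12 : perm_eq (u1 ++ [:: r1; r2]) u3.
  by apply: perm_trans p2; rewrite -cat_rcons -(cats1 u2) perm_cat2r.
have p123 : perm_eq (u1 ++ [:: r1; r2; r3]) t.
  apply: perm_trans p3; rewrite -(cats1 u3).
  by rewrite -[_ ++ _]/(u1 ++ [:: r1; r2] ++ [:: r3]) catA perm_cat2r.
have rp : removable r3.-1 u1.
  apply: rem y1 _ _; last by rewrite neq_ltn; move: lt12 lt23; clear; lia.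
  by apply: (removable_between yt h2 h3 lt23); rewrite cat_rcons.
have rq : removable r2.-1 u1.
  by apply: (removable_between (yp _ _ y3) h1' h2' lt12).
have lt : r2.-1 < r3.-1 by move: lt12 lt23; clear; lia.
have [s [ys _ ps]] := two_corners (yp _ _ y1) rq rp lt.
exists s, r3.-1, r2.-1, r3.-1.-1.
rewrite -[_ :: _]/([:: r3.-1.-1; r2.-1; r3.-1] ++ [:: r1; r2; r3]) catA; split.
- have y12 : yam (rcons u1 r1 ++ [:: r2]).
    by apply: (yam_perm_cat _ y1 (s := u2)); rewrite ?cats1 // perm_sym.
  have y123 : yam ((rcons u1 r1 ++ [:: r2]) ++ [:: r3]).
    apply: (yam_perm_cat _ y12 (s := u3)); rewrite ?cats1 // perm_sym.
    by rewrite -cats1 cat_rcons.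
  rewrite cat_rcons -catA /= in y123; apply: (yam_perm_cat _ _ y123).
    by rewrite perm_sym; apply: perm_trans ps; rewrite perm_cat2l.
  exact: ys.
- by apply: perm_trans p123; rewrite perm_cat2r.
- by move: lt12 lt23 lt; clear; lia.
Qed.

(* Colour sequences reaching all 16 words of the class of the loop below. *)
Definition class_walks : seq (seq nat) :=
  [:: [::]; [:: 1]; [:: 3]; [:: 1; 0]; [:: 3; 1]; [:: 1; 0; 2]; [:: 3; 1; 0];
      [:: 3; 1; 2]; [:: 1; 0; 2; 0]; [:: 1; 0; 2; 3]; [:: 3; 1; 0; 2];
      [:: 1; 0; 2; 0; 3]; [:: 3; 1; 0; 2; 1]; [:: 1; 0; 2; 0; 3; 2];
      [:: 3; 1; 0; 2; 1; 3]; [:: 1; 0; 2; 0; 3; 2; 0]].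

Definition word_class (h : seq nat) : seq (seq nat) :=
  [seq run dmove h ws | ws <- class_walks].

Definition all_below (n : nat) : pred (seq nat) := all (fun x => x < n).

(* Letters of the words are heights in reading order; cells with the same value
   of col may share a row. *)
Definition class_check (col : seq nat) (O : seq (seq nat)) : bool :=
  uniq [seq map (nth 0 col) p | p <- O] &&
  all (fun p => [&& size p == 6, all_below 6 p, all (fun c => dmove c p \in O) (iota 0 4)
     & pairwise (fun x y => (x < y) ==> (nth 0 col x < nth 0 col y)) p]) O.

Definition class_ok (col : seq nat) (O : seq (seq nat)) : Prop :=
  uniq [seq map (nth 0 col) p | p <- O] /\
  forall p, p \in O -> [/\ size p = 6, all_below 6 p,
    forall c, c < 4 -> dmove c p \in O
    & pairwise (fun x y => (x < y) ==> (nth 0 col x < nth 0 col y)) p].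

Lemma class_checkP col O : class_check col O -> class_ok col O.
Proof.
case/andP=> uO /allP aO; split=> // p /aO/and4P[/eqP sp bp /allP cp tp].
by split=> // c c4; apply: cp; rewrite mem_iota.
Qed.

Section Rows.
Variables (col rows : seq nat) (O : seq (seq nat)).
Hypothesis ok : class_ok col O.
Hypothesis mono : forall x y, x <= y < 6 -> nth 0 rows x <= nth 0 rows y.
Hypothesis strict : forall x y, x < 6 -> y < 6 -> nth 0 col x < nth 0 col y ->
  nth 0 rows x < nth 0 rows y.
Let rowof := map (nth 0 rows).

(** A move only compares rows by [<=]. Weak monotonicity keeps a descent of heights, and a rise of
    heights along a word of the class joins cells whose rows differ by [strict]. *)
Lemma class_dmove p c : p \in O -> dmove c (rowof p) = rowof (dmove c p).
Proof.
case: ok => _ /(_ p)H /H[sp bp _ /(pairwiseP 0) tp].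
apply: dmove_map; apply/(pairwiseP 0) => i j ip jp ij.
have [xi yj] := (all_nthP 0 bp i ip, all_nthP 0 bp j jp).
have := tp i j ip jp ij; case: (ltnP (nth 0 p i) (nth 0 p j)) => [lt /= /strict|le _].
  by move=> /(_ xi yj); rewrite ltnNge => /negbTE->.
by rewrite mono // le.
Qed.

Lemma class_run p ws : p \in O -> all_below 4 ws ->
  run dmove p ws \in O /\ run dmove (rowof p) ws = rowof (run dmove p ws).
Proof.
move=> pO; elim/last_ind: ws => //= ws c IH; rewrite /all_below all_rcons !run_rcons.
move=> /andP[c4 /IH[rO ->]]; rewrite class_dmove //; split=> //.
by case: ok => _ /(_ _ rO)[_ _ /(_ c c4)].
Qed.

Lemma class_inj : {in O &, injective rowof}.
Proof.
move=> p q pO qO e; case: ok => /uniq_map_inj inj H; apply: (inj p q pO qO).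
have [[sp bp _ _] [sq bq _ _]] := (H p pO, H q qO).
apply: (@eq_from_nth _ 0); rewrite !size_map ?sp ?sq // => i i6.
rewrite !(nth_map 0) ?sp ?sq //; have := congr1 (nth 0 ^~ i) e.
rewrite !(nth_map 0) ?sp ?sq // => ei.
have [xi yi] := (all_nthP 0 bp i, all_nthP 0 bq i); rewrite sp sq in xi yi.
have s1 := strict (xi i6) (yi i6); have s2 := strict (yi i6) (xi i6).
by case: (ltngtP (nth 0 col (nth 0 p i)) (nth 0 col (nth 0 q i))) => // [/s1|/s2];
  rewrite ei ltnn.
Qed.
End Rows.

Section Faithful.
Variables (V : finType) (E : nat -> V -> V) (sg : V -> nat -> bool) (L : nat).
Hypothesis G : dual_graph E sg L.
Variables (c : nat) (psi : V -> seq nat).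
Hypotheses (cL : c.+2 < L) (C : covering E sg c.+3 psi)
  (F : forall v w, reach E (lower c.+2) v w -> psi v = psi w -> v = w).

Let EK := EK G.
Let linked := reach E (lower c.+2).
Let c_le : c <= c.+2. Proof. exact: leqW. Qed.

Let size_psi := cover_size C.
Let yam_psi := cover_yam C.
Let sg_psi := cover_sg C.
Lemma psi_E v d : d.+2 < c.+2 -> psi (E d v) = dmove d (psi v).
Proof. by move=> dc; apply: (cover_E C); apply: ltnW. Qed.

Lemma linkedS v w : linked v w -> linked w v.
Proof. by apply: (reachS G); apply: ltnW. Qed.

Lemma linkedT v w x : linked v w -> linked w x -> linked v x.
Proof. exact: reach_trans. Qed.

Lemma last_linked v w : linked v w -> last 0 (psi v) = last 0 (psi w).
Proof.
move=> [cs ok ->]; have [s [x [y [z [sc e]]]]] := psi_end size_psi v.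
have e' : psi v = (s ++ [:: x; y]) ++ [:: z] by rewrite e -catA.
rewrite (psi_run_low psi_E e' (leqnn _) _ ok) ?e ?last_cat //.
by rewrite size_cat sc addn2.
Qed.

(** A top edge leaves the component of the lower colours only if it moves the new letter to another
    corner. *)
Lemma top_edge v s x y z : psi v = s ++ [:: x; y; z] ->
  linked v (E c v) \/ between3 y x z /\ psi (E c v) = s ++ [:: x; z; y].
Proof.
move=> e; have sc := size_start size_psi e.
case: (boolP ((y <= x) == (z <= y))) => [fix_v|adm].
  have /eqP-> : E c v == v.
    by apply/negPn; rewrite (E_neq G cL size_psi sg_psi e) fix_v.
  by left; apply: reach_refl.
case: (boolP ((y < z <= x) || (x < z <= y))) => [m|nm].
  by left; have [] := new_letter_between G cL size_psi yam_psi sg_psi psi_E e m.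
right; have b : between3 y x z by move: adm nm; rewrite /between3; clear; lia.
by rewrite (cover_E C) // e (dmove_end _ sc) /= move3_mid0.
Qed.

(** This is Axiom 6 for the colour [c], with walks that may pause. *)
Definition few_top : Prop := forall v w, reach E (lower c.+3) v w ->
  exists cs, [/\ all (lower c.+3) cs, count_mem c cs <= 1 & w = run E v cs].

Lemma lower_top d : lower c.+3 d = (d == c) || lower c.+2 d.
Proof. by rewrite /lower !ltnS leq_eqVlt. Qed.

Lemma lower_notin cs : all (lower c.+3) cs -> c \notin cs -> all (lower c.+2) cs.
Proof.
move=> /allP ok nc; apply/allP => d dcs; have := ok d dcs; rewrite lower_top.
by case/orP => [/eqP dc|//]; rewrite -dc dcs in nc.
Qed.

Definition linked1 v w := linked v w \/ exists2 a, linked v a & linked (E c a) w.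

Lemma linked1P v w : linked1 v w <->
  exists cs, [/\ all (lower c.+3) cs, count_mem c cs <= 1 & w = run E v cs].
Proof.
have nc cs : all (lower c.+2) cs -> all (lower c.+3) cs /\ count_mem c cs = 0.
  move=> ok; split; first by apply: sub_all ok; apply: lower_sub.
  apply/count_memPn; apply/negP => cc; move/allP/(_ c cc): ok.
  by rewrite /lower ltnn.
split=> [[[cs ok ->]|[a [cs ok ->] [cs' ok' ->]]]|[cs [ok cnt ->]]].
- by have [? n] := nc _ ok; exists cs; rewrite n.
- exists (cs ++ c :: cs'); have [k1 n1] := nc _ ok; have [k2 n2] := nc _ ok'.
  rewrite all_cat k1 /= k2 lower_top eqxx count_cat /= n1 n2 eqxx.
  by split=> //; rewrite run_cat.
case: (boolP (c \in cs)) => [/splitPr ccs|ncs]; last first.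
  by left; exists cs => //; apply: lower_notin.
case: ccs ok cnt => cs1 cs2; rewrite all_cat count_cat /= eqxx => /and3P[ok1 _ ok2] cnt.
have [n1 n2] : count_mem c cs1 = 0 /\ count_mem c cs2 = 0.
  by move: cnt; set a := count _ _; set b := count _ _; clear; lia.
right; rewrite run_cat; exists (run E v cs1); apply: reach_run; apply: lower_notin => //.
  by apply/count_memPn.
by apply/count_memPn.
Qed.

(** Equal labels have the new letter in one corner, while a top edge that leaves the component of
    the lower colours changes this corner. So the walk stays in that component, where [F]
    applies. *)
Lemma few_top_faithful : few_top -> faithful E c.+3 psi.
Proof.
move=> few v w /few/linked1P[vw|[a va aw]]; first exact: F.
move=> e; have [s [x [y [z [sc ea]]]]] := psi_end size_psi a.
have [aa|[b eb]] := top_edge ea; first by apply: F e; apply: linkedT va (linkedT aa aw).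
have := last_linked aw; rewrite -e (last_linked va) ea eb !last_cat /=.
by move: b; rewrite /between3; clear; lia.
Qed.

Lemma psi_perm v w : reach E (lower c.+3) v w -> perm_eq (psi v) (psi w).
Proof. exact: cover_perm C. Qed.

Lemma linked_perm v w : linked v w -> perm_eq (psi v) (psi w).
Proof. by move=> vw; apply: psi_perm; apply: reach_sub vw; apply: lower_sub. Qed.

(** Which component a top edge leads to depends only on the component it starts from and on the two
    corners it exchanges. A square replaces [x] by [x'], a rearrangement of the first [c] letters
    then leads to [a'] by [F], and both commute with the top edge. *)
Lemma same_neighbour a a' s s' x x' y z : linked a a' ->
  psi a = s ++ [:: x; y; z] -> psi a' = s' ++ [:: x'; y; z] ->
  between3 y x z -> between3 y x' z -> linked (E c a) (E c a').
Proof.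
move=> aa e e' b b'; have sc := size_start size_psi e.
have sc' := size_start size_psi e'.
have pe : perm_eq (rcons s x) (rcons s' x').
  by have := linked_perm aa; rewrite e e' -(cat_rcons x s) -(cat_rcons x' s') perm_cat2r.
have yx' : yam (rcons s' x').
  by have := yam_psi a'; rewrite e' -cat_rcons yam_cat => /andP[].
have rx' : removable x' (rcons s x) by rewrite (removable_perm _ pe) removable_last.
have [|cs [s1 [ok e1 comm]]] := square G cL size_psi yam_psi sg_psi psi_E e rx'.
  by move: b b'; rewrite /between3; clear; lia.
have okm : all (lower c.+2) cs by apply: sub_all ok; apply: lower_sub.
set a1 := run E a cs in e1 comm.
have aa1 : linked a a1 by apply: reach_run.
have sc1 := size_start size_psi e1.
have pe1 : perm_eq s1 s'.
  rewrite -(perm_cat2r [:: x'; y; z]) -e1 -e'; apply: linked_perm.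
  exact: linkedT (linkedS aa1) aa.
have [cs' ok' e2] : exists2 cs', all (lower c) cs' &
    psi (run E a1 cs') = s' ++ [:: x'; y; z].
  rewrite -[in lower c]sc1; apply: (psi_lift yam_psi psi_E e1); rewrite ?sc1 //.
  by move: yx'; rewrite yam_rcons => /andP[].
have okm' : all (lower c.+2) cs' by apply: sub_all ok'; apply: lower_sub.
have ea' : a' = run E a1 cs'.
  apply: F; last by rewrite e2.
  by apply: linkedT (linkedS aa) (linkedT aa1 _); apply: reach_run.
rewrite ea' (run_top G cL _ ok') comm.
by apply: linkedT (reach_run _ _ okm) (reach_run _ _ okm').
Qed.

(** By [move3_mid0] the top edge at such a [v] takes the new letter from row [z] to row [y]. *)
Definition edge_at (v : V) (y z : nat) : Prop :=
  exists s x, psi v = s ++ [:: x; y; z] /\ between3 y x z.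

(* Top edges and walks in lower colours alternate along v 0, ..., v 5, which
   visit the components with the new letter in rows r1, r2, r3. *)
Definition hexagon (v : nat -> V) (r1 r2 r3 : nat) : Prop :=
  [/\ [/\ E c (v 0) = v 1, E c (v 2) = v 3 & E c (v 4) = v 5],
      [/\ linked (v 1) (v 2), linked (v 3) (v 4) & linked (v 5) (v 0)],
      [/\ edge_at (v 0) r2 r3, edge_at (v 1) r3 r2 & edge_at (v 2) r1 r2]
    & [/\ edge_at (v 3) r2 r1, edge_at (v 4) r3 r1 & edge_at (v 5) r1 r3]].

Lemma edge_last v y z : edge_at v y z -> last 0 (psi v) = z.
Proof. by move=> [s [x [-> _]]]; rewrite last_cat. Qed.

Lemma linked_lift b t : yam t -> perm_eq (psi b) t -> last 0 (psi b) = last 0 t ->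
  exists2 b', linked b b' & psi b' = t.
Proof.
move=> yt pe el; have [s [x [y [z [sc e]]]]] := psi_end size_psi b.
have := perm_size pe; rewrite size_psi.
case/lastP: t yt pe el => // t z' yt pe; rewrite e last_cat last_rcons /= => ez st.
have e2 : psi b = (s ++ [:: x; y]) ++ [:: z] by rewrite e -catA.
have s2 : size (s ++ [:: x; y]) = c.+2 by rewrite size_cat sc addn2.
rewrite -ez in yt pe *.
have [cs ok ecs] : exists2 cs, all (lower c.+2) cs & psi (run E b cs) = t ++ [:: z].
  rewrite -[in lower _]s2; apply: (psi_lift yam_psi psi_E e2); first by rewrite s2.
    by move: yt; rewrite yam_rcons => /andP[].
  by move: pe; rewrite e2 -cats1 perm_cat2r.
by exists (run E b cs); [apply: reach_run | rewrite ecs cats1].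
Qed.

(** The label at the end of the walk from [v0] is lifted into the component of [b], and the walk is
    run backwards from there. *)
Lemma linked_walk b v0 ws : all (lower c.+3) ws -> perm_eq (psi b) (psi v0) ->
  last 0 (psi b) = last 0 (psi (run E v0 ws)) ->
  exists2 u, psi u = psi v0 & linked b (run E u ws).
Proof.
move=> ok pe el; have rok : all (lower c.+3) (rev ws) by rewrite all_rev.
have K v cs : all (lower c.+3) cs -> run E (run E v cs) (rev cs) = v.
  move=> ok'; apply: (run_revK (P := lower c.+3)) => // a w ac.
  by apply: EK; apply: leq_trans ac _.
have [b1 bb1 e1] := linked_lift (yam_psi _)
  (perm_trans pe (psi_perm (reach_run _ _ ok))) el.
exists (run E b1 (rev ws)); last by rewrite -[X in run E _ X]revK K.
by rewrite (cover_run _ C rok) e1 -(cover_run _ C rok) K.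
Qed.

Hypothesis small4 : forall d v, d + 5 < L ->
  reach_bounded E (fun x => d <= x < d + 4) v 16.

(** * Closed walks in the class of 16 words *)

Section Loop.
Variables (d : nat) (s rows col h : seq nat) (O : seq (seq nat)).
Hypotheses (cd : c = d + 3) (sd : size s = d) (ok : class_ok col O)
  (eO : O = word_class h).
Hypothesis mono : forall x y, x <= y < 6 -> nth 0 rows x <= nth 0 rows y.
Hypothesis strict : forall x y, x < 6 -> y < 6 -> nth 0 col x < nth 0 col y ->
  nth 0 rows x < nth 0 rows y.
Let rowof := map (nth 0 rows).
Let shift := map (addn d).

Lemma all_shift k ws : k <= 4 -> all_below k ws -> all (lower (d + k).+2) (shift ws).
Proof.
move=> k4 /allP ok1; apply/allP => _ /mapP[x xs ->].
by rewrite /lower !ltnS ltn_add2l; apply: ok1.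
Qed.

Lemma loop_run u p ws : p \in O -> psi u = s ++ rowof p -> all_below 4 ws ->
  psi (run E u (shift ws)) = s ++ rowof (run dmove p ws).
Proof.
move=> pO e ok4; have := all_shift (leqnn 4) ok4.
rewrite -[4]/(3 + 1) addnA -cd addn1 => okc; rewrite (cover_run _ C okc) e.
have [_ er] := class_run ok mono strict pO ok4; rewrite /rowof -er.
elim/last_ind: ws {er ok4 okc} => //= ws x IH; rewrite /shift map_rcons !run_rcons IH.
by rewrite -sd dmove_cat.
Qed.

(* The 16 words of the class give 16 vertices with distinct tableaux, so the
   component has no others. *)
Lemma loop_inj u p ws : p \in O -> psi u = s ++ rowof p -> all_below 4 ws ->
  run dmove p ws = p -> run E u (shift ws) = u.
Proof.
move=> pO e ok4 ep.
have [ws0 ws0in ep0] : exists2 ws, ws \in class_walks & p = run dmove h ws.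
  by apply/mapP; rewrite eO in pO.
have W4 : forall w, w \in class_walks -> all_below 4 w by apply/allP.
have ok0 := W4 _ ws0in.
have revok : all_below 4 (rev ws0) by rewrite /all_below all_rev.
have hO : h \in O by rewrite eO; apply/mapP; exists [::].
have ph : run dmove p (rev ws0) = h.
  rewrite ep0 (run_revK (P := predT)) //; first by move=> ? ? _; apply: dmoveK.
  exact/all_predT.
pose u0 := run E u (shift (rev ws0)).
have e0 : psi u0 = s ++ rowof h by rewrite /u0 (loop_run pO e revok) ph.
pose l := [seq run E u0 (shift w) | w <- class_walks].
have el : map psi l = [seq s ++ rowof q | q <- O].
  rewrite /l eO /word_class -!map_comp; apply/eq_in_map => w wW /=.
  by rewrite (loop_run hO e0) // W4.
have ul : uniq (map psi l).
  rewrite el map_inj_in_uniq; first by case: ok => /map_uniq.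
  by move=> q q' qO qO' /cat_inj[]// _; apply: (class_inj ok strict qO qO').
have S w : all_below 4 w -> all (fun x => d <= x < d + 4) (shift w).
  move=> /allP w4; apply/allP => _ /mapP[x xw ->].
  by rewrite leq_addr ltn_add2l; apply: w4.
have ul0 : u \in l.
  apply/mapP; exists ws0 => //; rewrite /u0 /shift map_rev.
  have := @run_revK _ E (lower c.+3) u (rev (map (addn d) ws0)); rewrite revK => -> //.
    by move=> a w ac; apply: EK; apply: leq_trans ac _.
  rewrite all_rev; have := all_shift (leqnn 4) ok0.
  by rewrite -[4]/(3 + 1) addnA -cd addn1.
apply/eqP/negPn/negP => ne.
have dL : d + 5 < L by move: cL; rewrite cd; clear; lia.
have : 17 <= 16; last by [].
apply: leq_trans (small4 dL (v := u) (s := run E u (shift ws) :: l) _ _).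
- by [].
- rewrite cons_uniq (map_uniq ul) andbT; apply/negP => inl.
  have ei := uniq_map_inj ul inl ul0; move/eqP: ne; apply; apply: ei.
  by rewrite (loop_run pO e ok4) ep e.
- move=> w; rewrite inE => /orP[/eqP->|/mapP[w' /W4 w'4 ->]].
    by apply: reach_run; apply: S.
  apply: (@reach_trans _ _ _ _ u0); apply: reach_run; exact: S.
Qed.

Lemma loop_edge u p : p \in O -> psi u = s ++ rowof p ->
  psi (E c u) = s ++ rowof (dmove 3 p).
Proof. by move=> pO e; rewrite cd addnC -(loop_run (ws := [:: 3]) pO e) //= addnC. Qed.

Lemma loop_linked u ws : all_below 3 ws -> linked u (run E u (shift ws)).
Proof. by move=> w3; apply: reach_run; rewrite cd; apply: all_shift. Qed.

Definition edge_word (p : seq nat) (y z : nat) : bool :=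
  let x := nth 0 p 3 in
  [&& size p == 6, nth 0 p 4 == y, nth 0 p 5 == z, maxn y z < 6
    & [&& y <= x, x < z & nth 0 col x < nth 0 col z] ||
      [&& z <= x, x < y & nth 0 col x < nth 0 col y]].

Lemma edge_wordP u p y z : psi u = s ++ rowof p -> edge_word p y z ->
  edge_at u (nth 0 rows y) (nth 0 rows z).
Proof.
move=> e /and5P[]; case: p e => [|p0 [|p1 [|p2 [|x [|y' [|z' []]]]]]] //= e _.
move=> /eqP ey /eqP ez yz6 H; rewrite ey ez in e; exists (s ++ map (nth 0 rows) [:: p0; p1;
  p2]), (nth 0 rows x).
split; first by rewrite e -catA.
rewrite gtn_max in yz6; case/andP: yz6 => y6 z6.
rewrite /between3; case/orP: H => /and3P[le lt co]; apply/orP; [left|right].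
  have x6 := ltn_trans lt z6.
  by apply/andP; split; [apply: mono; rewrite le | apply: strict].
have x6 := ltn_trans lt y6.
by apply/andP; split; [apply: mono; rewrite le | apply: strict].
Qed.

(** The corners are numbered 0, 1, 2 and have heights 0, [k], 5. The word [wij] ends with letters in
    corners [i] and [j], and [h] plays the part of [w12]. Colour 3 exchanges the last two letters;
    each loop keeps the last letter and brings the other corner next to it. *)
Variables (k : nat) (loop1 loop2 loop3 w21 w01 w10 w20 w02 : seq nat).
Hypotheses (L1 : all_below 3 loop1) (L2 : all_below 3 loop2) (L3 : all_below 3 loop3).
Hypotheses (E21 : dmove 3 h = w21) (E01 : run dmove w21 loop1 = w01)
  (E10 : dmove 3 w01 = w10) (E20 : run dmove w10 loop2 = w20)
  (E02 : dmove 3 w20 = w02) (E12 : run dmove w02 loop3 = h).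
Hypotheses (D12 : edge_word h k 5) (D21 : edge_word w21 5 k) (D01 : edge_word w01 0 k)
  (D10 : edge_word w10 k 0) (D20 : edge_word w20 5 0) (D02 : edge_word w02 0 5).

Lemma loop_hexagon u : psi u = s ++ rowof h ->
  exists v, [/\ hexagon v (nth 0 rows 0) (nth 0 rows k) (nth 0 rows 5), v 0 = u,
    v 1 = E c u & v 3 = E c (run E (E c u) (shift loop1))].
Proof.
move=> e0.
have step p cs q : p \in O -> all_below 4 cs -> run dmove p cs = q -> q \in O.
  by move=> pO c4 <-; have [] := class_run ok mono strict pO c4.
have wk l : all_below 3 l -> all_below 4 l by apply: sub_all => a; apply: ltnW.
have O12 : h \in O by rewrite eO; apply/mapP; exists [::].
have O21 : w21 \in O by apply: (step h [:: 3] _ O12 isT E21).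
have O01 : w01 \in O by apply: (step w21 loop1 _ O21 (wk _ L1) E01).
have O10 : w10 \in O by apply: (step w01 [:: 3] _ O01 isT E10).
have O20 : w20 \in O by apply: (step w10 loop2 _ O10 (wk _ L2) E20).
have O02 : w02 \in O by apply: (step w20 [:: 3] _ O20 isT E02).
have e21 := loop_edge O12 e0; rewrite E21 in e21.
have e01 := loop_run O21 e21 (wk _ L1); rewrite E01 in e01.
have e10 := loop_edge O01 e01; rewrite E10 in e10.
have e20 := loop_run O10 e10 (wk _ L2); rewrite E20 in e20.
have e02 := loop_edge O20 e20; rewrite E02 in e02.
set v21 := E c u in e21 e01 e10 e20 e02 *; set v01 := run E v21 _ in e01 e10 e20 e02 *.
set v10 := E c v01 in e10 e20 e02 *; set v20 := run E v10 _ in e20 e02.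
set v02 := E c v20 in e02.
(* The six steps lead from [h] back to [h] on words; [loop_inj] closes the walk on vertices as
   well. *)
have l3 : linked v02 u.
  have : all_below 4 (3 :: loop1 ++ 3 :: loop2 ++ 3 :: loop3).
    move: (wk _ L1) (wk _ L2) (wk _ L3); rewrite /all_below /= => W1 W2 W3.
    by rewrite all_cat /= all_cat /= W1 W2 W3.
  move=> /(loop_inj O12 e0); rewrite run_cons E21 run_cat E01 run_cons E10 run_cat E20.
  rewrite run_cons E02 E12 => /(_ erefl) eu.
  rewrite -[X in linked _ X]eu /shift map_cons map_cat map_cons map_cat map_cons.
  rewrite -cd run_cons run_cat run_cons run_cat run_cons.
  exact: loop_linked.
exists (fun i => nth u [:: u; v21; v01; v10; v20; v02] i); split=> //; split=> /=.
- by split.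
- by split=> //; apply: loop_linked.
- by split; [apply: edge_wordP e0 D12|apply: edge_wordP e21 D21|apply: edge_wordP e01 D01].
- by split; [apply: edge_wordP e10 D10|apply: edge_wordP e20 D20|apply: edge_wordP e02 D02].
Qed.

Lemma loop_around b v0 : psi v0 = s ++ rowof h -> perm_eq (psi b) (psi v0) ->
  last 0 (psi b) \in [:: nth 0 rows 0; nth 0 rows k; nth 0 rows 5] ->
  exists v, hexagon v (nth 0 rows 0) (nth 0 rows k) (nth 0 rows 5) /\
    [\/ linked b (v 0), linked b (v 1) | linked b (v 3)].
Proof.
move=> e0 pe bl.
have [v [H v0E v1E v3E]] := loop_hexagon e0.
have [_ _ [A0 A1 _] [A3 _ _]] := H.
have l3 : all (lower c.+2) (shift loop1) by rewrite cd; apply: all_shift.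
have ok3 : all (lower c.+3) (c :: rcons (shift loop1) c).
  rewrite /= all_rcons !lower_top eqxx /=.
  by apply: sub_all l3; apply: lower_sub.
have ok1 : all (lower c.+3) [:: c] by rewrite /= lower_top eqxx.
have W ws (ok1' : all (lower c.+3) ws) (el : last 0 (psi b) = last 0 (psi (run E v0 ws))) :
  exists v', hexagon v' (nth 0 rows 0) (nth 0 rows k) (nth 0 rows 5) /\
     exists u, [/\ linked b (run E u ws), v' 0 = u, v' 1 = E c u
       & v' 3 = E c (run E (E c u) (shift loop1))].
  have [u eu bu] := linked_walk ok1' pe el; rewrite e0 in eu.
  by have [v' [H' q1 q2 q3]] := loop_hexagon eu; exists v'; split=> //; exists u.
move: bl; rewrite !inE => /or3P[]/eqP el.
- have [|v' [H' [u [bu _ _ q]]]] := W _ ok3.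
    by rewrite run_cons run_rcons -v3E (edge_last A3).
  by exists v'; split=> //; apply: Or33; rewrite q -run_rcons -run_cons.
- have [|v' [H' [u [bu _ q _]]]] := W _ ok1; first by rewrite run_cons -v1E (edge_last A1).
  by exists v'; split=> //; apply: Or32; rewrite q.
- have [|v' [H' [u [bu q _ _]]]] := W _ (isT : all (lower c.+3) [::]).
    by rewrite /= -v0E (edge_last A0).
  by exists v'; split=> //; apply: Or31; rewrite q.
Qed.

End Loop.

Lemma hexagon_exists b r1 r2 r3 : removable r1 (psi b) -> removable r2 (psi b) ->
  removable r3 (psi b) -> r1 < r2 < r3 -> last 0 (psi b) \in [:: r1; r2; r3] ->
  exists v, hexagon v r1 r2 r3 /\ [\/ linked b (v 0), linked b (v 1) | linked b (v 3)].
Proof.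
move=> h1 h2 h3 r123 bl.
have [s [p [q [r [yt pe ord]]]]] := three_corners (yam_psi b) h1 h2 h3 r123.
pose d := size s; have cd : c = d + 3.
  have := perm_size pe; rewrite size_psi size_cat /= -/d; clear; lia.
have [v0 bv0 e0] := cover_lift C yt (etrans (perm_sym _ _) pe).
(* This exchanges [p] and [r1], so that [p], which lies between [r2] and [r3], becomes the third
   last letter. *)
pose v1 := E (d + 1) v0.
have dc : lower c.+3 (d + 1) by rewrite /lower cd; clear; lia.
have pe1 : perm_eq (psi b) (psi v1).
  by apply: psi_perm; apply: reach_trans bv0 (reach1 _ _ _).
have e1 : psi v1 = s ++ [:: r; q; r1; p; r2; r3].
  rewrite (cover_E C) // e0 dmove_cat /= move3_mid0 //.
  by move: ord r123; clear; lia.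
(* The order of the six rows is known except for [r] and [r2]. In each case [rows] lists them
   upwards, [h] is the label of [v1] written in heights, and the next-to-last numeral, [k], is the
   height of [r2]: equal values in [col] mark rows that may coincide. *)
case: (leqP r2 r) => r2r.
- pose rows := [:: r1; q; r2; r; p; r3]; pose h := [:: 3; 1; 0; 4; 2; 5].
  pose col := [:: 0; 0; 1; 1; 2; 3].
  have ok : class_ok col (word_class h) by apply: class_checkP; vm_compute.
  have mono x y : x <= y < 6 -> nth 0 rows x <= nth 0 rows y.
    move: ord r123 r2r; rewrite /rows; clear.
    case: x => [|[|[|[|[|[|x]]]]]]; case: y => [|[|[|[|[|[|y]]]]]] //=; lia.
  have strict x y : x < 6 -> y < 6 -> nth 0 col x < nth 0 col y -> nth 0 rows x < nth 0 rows y.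
    move: ord r123 r2r; rewrite /rows /col; clear.
    case: x => [|[|[|[|[|[|x]]]]]] //; case: y => [|[|[|[|[|[|y]]]]]] //=; lia.
  exact: (@loop_around d s rows col h (word_class h) cd (erefl d) ok erefl mono strict 2
    [:: 1; 0; 2; 1] [:: 1; 0; 2; 0] [:: 2; 0; 1] _ _ _ _ _ isT isT isT
    erefl erefl erefl erefl erefl erefl isT isT isT isT isT isT b v1 e1 pe1 bl).
- pose rows := [:: r1; q; r; r2; p; r3]; pose h := [:: 2; 1; 0; 4; 3; 5].
  pose col := [:: 0; 0; 0; 1; 1; 2].
  have ok : class_ok col (word_class h) by apply: class_checkP; vm_compute.
  have mono x y : x <= y < 6 -> nth 0 rows x <= nth 0 rows y.
    move: ord r123 r2r; rewrite /rows; clear.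
    case: x => [|[|[|[|[|[|x]]]]]]; case: y => [|[|[|[|[|[|y]]]]]] //=; lia.
  have strict x y : x < 6 -> y < 6 -> nth 0 col x < nth 0 col y -> nth 0 rows x < nth 0 rows y.
    move: ord r123 r2r; rewrite /rows /col; clear.
    case: x => [|[|[|[|[|[|x]]]]]] //; case: y => [|[|[|[|[|[|y]]]]]] //=; lia.
  exact: (@loop_around d s rows col h (word_class h) cd (erefl d) ok erefl mono strict 3
    [:: 1; 0; 2; 1] [:: 1; 0; 2; 0] [:: 2; 0; 1] _ _ _ _ _ isT isT isT
    erefl erefl erefl erefl erefl erefl isT isT isT isT isT isT b v1 e1 pe1 bl).
Qed.

(** The three components visited by the hexagon are pairwise joined by top edges. Hence a passage
    from corner [A] through the component of [b] to corner [D] can be replaced by the single top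
    edge at [a]. *)
Lemma hexagon_triangle v b r1 r2 r3 A D : hexagon v r1 r2 r3 -> r1 < r2 < r3 ->
  [\/ linked b (v 0), linked b (v 1) | linked b (v 3)] ->
  uniq [:: A; last 0 (psi b); D] -> A \in [:: r1; r2; r3] -> D \in [:: r1; r2; r3] ->
  exists bA bD a, [/\ linked b bA /\ linked b bD, edge_at bA A (last 0 (psi b)),
    edge_at bD D (last 0 (psi b)), linked (E c bA) a & linked (E c a) (E c bD)].
Proof.
move=> [[E0 E2 E4] [l12 l34 l50] [A0 A1 A2] [A3 A4 A5]] r123 bl.
have EV u w : E c u = w -> E c w = u by move=> <-; apply: EK.
have [[E1 E3] E5] := (EV _ _ E0, EV _ _ E2, EV _ _ E4).
have [[l21 l43] l05] := (linkedS l12, linkedS l34, linkedS l50).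
have R u : linked u u by apply: reach_refl.
case: bl => bl; rewrite (last_linked bl) ?(edge_last A0) ?(edge_last A1) ?(edge_last A3);
  rewrite /= !inE negb_or => /and3P[/andP[AB AD] BD _] /or3P[]/eqP eA /or3P[]/eqP eD; subst A D;
  rewrite ?eqxx // in AB AD BD.
- by exists (v 5), (v 0), (v 3); rewrite E5 E3 E0; split=> //; split=> //; apply: linkedT bl _.
- by exists (v 0), (v 5), (v 2); rewrite E0 E2 E5; split=> //; split=> //; apply: linkedT bl _.
- by exists (v 2), (v 1), (v 4); rewrite E2 E4 E1; split=> //; split=> //; apply: linkedT bl _.
- by exists (v 1), (v 2), (v 5); rewrite E1 E5 E2; split=> //; split=> //; apply: linkedT bl _.
- by exists (v 3), (v 4), (v 1); rewrite E3 E1 E4; split=> //; split=> //; apply: linkedT bl _.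
- by exists (v 4), (v 3), (v 0); rewrite E4 E0 E3; split=> //; split=> //; apply: linkedT bl _.
Qed.

(** If neither edge stays in its component, the new letter goes from row [z] to [y] and on to [D].
    For [D = z] the walk is back in the first component; otherwise these are three corners, and the
    hexagon supplies the shortcut, transferred to the given vertices by [same_neighbour]. *)
Lemma two_top_edges a b' : linked (E c a) b' -> linked1 a (E c b').
Proof.
set b := E c a => bb'; have Eb : E c b = a by apply: EK.
have [s [x [y [z [sc ea]]]]] := psi_end size_psi a.
have [s' [x' [D [B [sc' eb']]]]] := psi_end size_psi b'.
have [ab|[bt]] := top_edge ea.
  by right; exists b'; [apply: linkedT ab bb' | apply: reach_refl].
rewrite -/b => eb.
have ey : B = y by have := last_linked bb'; rewrite eb eb' !last_cat.
rewrite {}ey in eb'; have [bw|[bt' ew]] := top_edge eb'.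
  by right; exists a; [apply: reach_refl | apply: linkedT bb' bw].
have bt2 : between3 z x y by move: bt; rewrite /between3; clear; lia.
case: (eqVneq D z) => [eD|Dz].
  left; rewrite eD in eb' bt'; rewrite -Eb.
  exact: same_neighbour bb' eb eb' bt2 bt'.
have yb u : removable (last 0 (psi u)) (psi u).
  have := yam_psi u; have := size_psi u; case/lastP: (psi u) => // t r _.
  by rewrite last_rcons; apply: removable_last.
have bw : linked b' b by apply: linkedS.
have pw : perm_eq (psi b) (psi (E c b')).
  by apply: (perm_trans (linked_perm bb')); rewrite eb' ew perm_cat2l perm_cons;
     apply/permPl/(perm_catC [:: D] [:: y]).
have pa : perm_eq (psi b) (psi a).
  by rewrite eb ea perm_cat2l perm_cons; apply/permPl/(perm_catC [:: z] [:: y]).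
have [ry rz rD] : [/\ removable y (psi b), removable z (psi b) & removable D (psi b)].
  split.
  - by have := yb b; rewrite {1}eb last_cat.
  - by rewrite (removable_perm _ pa); have := yb a; rewrite {1}ea last_cat.
  - by rewrite (removable_perm _ pw); have := yb (E c b'); rewrite {1}ew last_cat.
have [r1 [r2 [r3 [r123 pr]]]] : exists r1 r2 r3,
    r1 < r2 < r3 /\ [:: z; y; D] =i [:: r1; r2; r3].
  have yz : y != z by move: bt; rewrite /between3; clear; lia.
  have yD : y != D by move: bt'; rewrite /between3; clear; lia.
  have P l l' : perm_eq l l' -> l =i l' := @perm_mem _ l l'.
  case: (ltngtP y z) yz => // yz _; case: (ltngtP y D) yD => // yD _;
  case: (ltngtP D z) Dz => // Dz _; try by exfalso; move: yz yD Dz; clear; lia.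
  - by exists y, D, z; split; [apply/andP | apply: P; apply/permP => f /=; clear; lia].
  - by exists y, z, D; split; [apply/andP | apply: P; apply/permP => f /=; clear; lia].
  - by exists D, y, z; split; [apply/andP | apply: P; apply/permP => f /=; clear; lia].
  - by exists z, y, D; split; [apply/andP | apply: P; apply/permP => f /=; clear; lia].
  - by exists D, z, y; split; [apply/andP | apply: P; apply/permP => f /=; clear; lia].
  - by exists z, D, y; split; [apply/andP | apply: P; apply/permP => f /=; clear; lia].
have rem r : r \in [:: r1; r2; r3] -> removable r (psi b).
  by rewrite -pr !inE => /or3P[]/eqP->.
have lb : last 0 (psi b) = y by rewrite eb last_cat.
have [m1 m2 m3] : [/\ r1 \in [:: r1; r2; r3], r2 \in [:: r1; r2; r3] & r3 \in [:: r1; r2; r3]].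
  by rewrite !inE !eqxx !orbT.
have lin : last 0 (psi b) \in [:: r1; r2; r3] by rewrite -pr lb !inE eqxx orbT.
have [v [H bl]] := hexagon_exists (rem _ m1) (rem _ m2) (rem _ m3) r123 lin.
have un : uniq [:: z; last 0 (psi b); D].
  by rewrite lb /= !inE negb_or; move: bt bt' Dz; rewrite /between3; clear; lia.
have [zin Din] : z \in [:: r1; r2; r3] /\ D \in [:: r1; r2; r3].
  by rewrite -!pr !inE !eqxx !orbT.
have [bA [bD [a2 [[bbA bbD] [sA [xA [eA btA]]] [sD [xD [eD btD]]] l1 l2]]]] :=
  hexagon_triangle H r123 bl un zin Din.
rewrite lb in eA btA eD btD.
right; exists a2.
  rewrite -Eb; apply: linkedT l1; exact: same_neighbour bbA eb eA bt2 btA.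
apply: linkedT l2 _; apply: linkedS.
by apply: (same_neighbour _ eb' eD bt' btD); apply: linkedT bw bbD.
Qed.

Lemma small_few_top : few_top.
Proof.
move=> v w [cs ok ->]; apply/linked1P.
elim/last_ind: cs ok => [_|cs d IH]; first by left; apply: reach_refl.
rewrite all_rcons lower_top run_rcons => /andP[dc /IH]; set u := run E v cs.
case: (eqVneq d c) dc => [-> _|_ /= dc]; last first.
  have ud : linked u (E d u) by apply: reach1.
  by case=> [vu|[a va au]]; [left; apply: linkedT ud|right; exists a => //; apply: linkedT ud].
case=> [vu|[a va /two_top_edges[aw|[a1 aa1 a1w]]]].
- by right; exists u => //; apply: reach_refl.
- by left; apply: linkedT aw.
- by right; exists a1 => //; apply: linkedT aa1.
Qed.

End Faithful.

(** * Induction on the number of letters *)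

Section Structure.
Variables (V : finType) (E : nat -> V -> V) (sg : V -> nat -> bool) (L : nat).
Hypothesis G : dual_graph E sg L.

Definition structured (k : nat) : Prop :=
  exists2 phi, covering E sg k phi & faithful E k phi.

Lemma structured1 : structured 1.
Proof.
exists (fun=> [:: 0]); first by split=> // v [].
by move=> v w [[|c cs] //= _ ->].
Qed.

(** [few_top] is asked only in the presence of the new covering, so that under Axiom 4+ it can be
    derived from it. *)
Lemma structured_step k : k.+1 < L -> structured k.+1 ->
  (forall c psi, c.+2 = k.+1 -> covering E sg c.+3 psi ->
     (forall v w, reach E (lower c.+2) v w -> psi v = psi w -> v = w) -> few_top E c) ->
  structured k.+2.
Proof.
move=> kL [phi C F] few; have [psi [sz y s e inj]] := extend G kL C F.
case: k kL C F few sz s e inj => [|c] kL C F few sz s e inj.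
  (* Two letters admit no colour, so there is no top edge to control. *)
  exists psi; first by split=> // v h.
  by move=> v w [[|h cs] //= _ ->].
have Cpsi := cover_top G kL sz y s e.
exists psi => //; apply: (few_top_faithful G kL Cpsi inj).
exact: few erefl Cpsi inj.
Qed.

Lemma few_top_structured : (forall c, c.+2 < L -> few_top E c) -> 0 < L -> structured L.
Proof.
move=> few L0; suff S l : l < L -> structured l.+1.
  by case: L S L0 => // l /(_ l (leqnn _)).
elim: l => [|l IH] lL; first exact: structured1.
apply: structured_step => //; first by apply: IH; rewrite // ltnW.
by move=> c psi [cl] _ _; apply: few; rewrite cl.
Qed.

Lemma small_structured :
  (forall d v, d + 5 < L -> reach_bounded E (fun x => d <= x < d + 4) v 16) ->
  0 < L -> structured L /\ forall c, c.+2 < L -> few_top E c.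
Proof.
move=> small L0.
have S l : l < L -> structured l.+1.
  elim: l => [|l IH] lL; first exact: structured1.
  apply: structured_step => //; first by apply: IH; rewrite // ltnW.
  by move=> c psi [cl] C inj; apply: (small_few_top G _ C inj small); rewrite cl.
split; first by case: L S L0 => // l /(_ l (leqnn _)).
move=> c cL; have [phi C F] := S c.+1 (ltnW cL).
have [psi [sz y s e inj]] := extend G cL C F.
refine (small_few_top G cL (cover_top G cL sz y s e) inj small).
Qed.
End Structure.

(** * Sizes of dual equivalence classes of words *)

(* A step is spent on each vertex and on each of its k edges, so 100 steps
   suffice for at most 16 vertices and k <= 4. *)
Fixpoint explore (k fuel : nat) (seen todo : seq (seq nat)) : seq (seq nat) :=
  if fuel is f.+1 then
    if todo is p :: todo' then
      if p \in seen then explore k f seen todo'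
      else explore k f (p :: seen) ([seq dmove c p | c <- iota 0 k] ++ todo')
    else seen
  else seen.

Definition orbit_check (k B : nat) (p : seq nat) : bool :=
  let O := explore k 100 [::] [:: p] in
  [&& size O <= B, p \in O & all (fun q => all (fun c => dmove c q \in O) (iota 0 k)) O].

Definition orbits_check (k B : nat) : Prop :=
  all (orbit_check k B) (permutations (iota 0 k.+2)).

Lemma orbits_check2 : orbits_check 2 3. Proof. by vm_compute. Qed.
Lemma orbits_check3 : orbits_check 3 6. Proof. by vm_compute. Qed.
Lemma orbits_check4 : orbits_check 4 16. Proof. by vm_compute. Qed.

Definition orbits_bounded (k B : nat) : Prop := forall p, perm_eq p (iota 0 k.+2) ->
  exists2 O : seq (seq nat), size O <= B &
    forall cs, all (fun c => c < k) cs -> run dmove p cs \in O.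

Lemma orbits_checkP k B : orbits_check k B -> orbits_bounded k B.
Proof.
move=> /allP ok p; rewrite -mem_permutations => /ok/and3P[sO pO /allP closed].
exists (explore k 100 [::] [:: p]) => // cs.
elim/last_ind: cs => // cs c IH; rewrite all_rcons run_rcons => /andP[ck /IH rO].
by have /allP := closed _ rO; apply; rewrite mem_iota.
Qed.

Lemma orbits_bounded2 : orbits_bounded 2 3.
Proof. exact: orbits_checkP orbits_check2. Qed.
Lemma orbits_bounded3 : orbits_bounded 3 6.
Proof. exact: orbits_checkP orbits_check3. Qed.
Lemma orbits_bounded4 : orbits_bounded 4 16.
Proof. exact: orbits_checkP orbits_check4. Qed.

(** * Standardization of words by ranks *)

Section Rank.
Variable p : seq nat.
Hypothesis up : uniq p.

Definition rank (x : nat) : nat := count (fun y => y < x) p.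

Lemma rank_mono : {in p &, {mono rank : x y / x <= y}}.
Proof.
have le x y : x <= y -> rank x <= rank y.
  by move=> xy; apply: sub_count => a /= ax; apply: leq_trans ax xy.
move=> x y xp yp; case: (leqP x y) => [/le//|yx].
apply/negbTE; rewrite -ltnNge /rank !(permP (perm_to_rem yp)) /= ltnn yx add0n add1n ltnS.
by apply: sub_count => a /= ay; apply: ltn_trans ay yx.
Qed.

Lemma rank_inj : {in p &, injective rank}.
Proof.
by move=> x y xp yp e; apply/eqP; rewrite eqn_leq -(rank_mono xp yp) -(rank_mono yp xp) e leqnn.
Qed.

Lemma rank_perm : perm_eq (map rank p) (iota 0 (size p)).
Proof.
have um : uniq (map rank p) by rewrite map_inj_in_uniq //; apply: rank_inj.
apply: uniq_perm => //; first exact: iota_uniq.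
have sub : {subset map rank p <= iota 0 (size p)}.
  move=> _ /mapP[x xp ->]; rewrite mem_iota /= /rank -count_predT.
  by rewrite !(permP (perm_to_rem xp)) /= ltnn add0n add1n ltnS; apply: sub_count.
by have [] := uniq_min_size um sub; rewrite // size_iota size_map.
Qed.

Lemma dmove_rank t c : perm_eq t p -> dmove c (map rank t) = map rank (dmove c t).
Proof.
move=> tp; apply: dmove_map; apply/(pairwiseP 0) => i j it jt _.
by rewrite rank_mono // -(perm_mem tp) mem_nth.
Qed.

Lemma run_rank cs : run dmove (map rank p) cs = map rank (run dmove p cs).
Proof.
elim/last_ind: cs => //= cs c IH; rewrite !run_rcons IH dmove_rank //.
exact: perm_run.
Qed.
End Rank.

(** The colours involved touch only the [k.+2] entries from place [e] on. Moves only compare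
    entries, so replacing these by their ranks reduces the count to permutations of an initial
    segment, where it was computed. *)
Lemma orbit_size k B p e (l : seq (seq nat)) : orbits_bounded k B -> uniq p ->
  e + k.+2 <= size p -> uniq l ->
  (forall q, q \in l -> exists2 cs, all (fun c => e <= c < e + k) cs & q = run dmove p cs) ->
  size l <= B.
Proof.
move=> bnd up ep ul lp.
pose s := take e p; pose w := take k.+2 (drop e p); pose r := drop (k.+2 + e) p.
have ee : p = s ++ w ++ r by rewrite /s /w /r -drop_drop !cat_take_drop.
have ss : size s = e by rewrite size_takel //; apply: leq_trans ep; apply: leq_addr.
have sw : size w = k.+2 by rewrite size_takel // size_drop leq_subRL //;
  apply: leq_trans ep; apply: leq_addr.
have uw : uniq w by rewrite take_uniq // drop_uniq.
have step cs : all (fun c => e <= c < e + k) cs ->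
    let cs' := [seq c - e | c <- cs] in
    all (fun c => c < k) cs' /\ run dmove p cs = s ++ run dmove w cs' ++ r.
  elim/last_ind: cs => //= cs c IH; rewrite all_rcons map_rcons all_rcons !run_rcons.
  move=> /andP[ec /IH[-> ->]]; split; first by move: ec; clear; lia.
  rewrite -[in LHS](subnKC (_ : e <= c)); last by case/andP: ec.
  rewrite -{1}ss dmove_cat dmove_catl // size_run sw; move: ec; clear; lia.
have [O sO OP] := bnd (map (rank w) w) (etrans (congr1 _ (congr1 _ (esym sw))) (rank_perm uw)).
pose f (q : seq nat) := map (rank w) (take k.+2 (drop e q)).
have lf q : q \in l -> exists2 cs, all (fun c => c < k) cs &
    q = s ++ run dmove w cs ++ r /\ f q = map (rank w) (run dmove w cs).
  move=> /lp[cs /step/=[ok eq] qe]; exists [seq c - e | c <- cs] => //.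
  split; first by rewrite qe.
  by rewrite /f qe eq drop_size_cat // take_size_cat // size_run.
apply: leq_trans sO; rewrite -(size_map f); apply: uniq_leq_size.
  rewrite map_inj_in_uniq // => q q' /lf[cs _ [-> ->]] /lf[cs' _ [-> ->]] eq.
  have W cs0 : all [in w] (run dmove w cs0).
    by apply/allP => x; rewrite (perm_mem (perm_run _ _)).
  by congr (_ ++ (_ ++ _)); apply: (inj_in_map (@rank_inj w) (W cs) (W cs')).
move=> _ /mapP[q /lf[cs ok [_ ->]] ->]; rewrite -run_rank //; exact: OP.
Qed.

(** Positions are counted from the end of the word: a letter read earlier gets the larger value, as
    with rows, so [dmove] serves for both. *)
Definition positions (w : seq nat) : seq nat :=
  [seq size w - index j w | j <- iota 1 (size w)].

Section Word.
Variables (n : nat).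
Definition std_word (w : seq nat) : bool := perm_eq w (iota 1 n).

Lemma std_size w : std_word w -> size w = n.
Proof. by move=> /perm_size; rewrite size_iota. Qed.

Lemma std_mem w j : std_word w -> (j \in w) = (0 < j <= n).
Proof. by move=> /perm_mem ->; rewrite mem_iota add1n ltnS. Qed.

Lemma std_uniq w : std_word w -> uniq w.
Proof. by move=> /perm_uniq ->; apply: iota_uniq. Qed.

Lemma positions_uniq w : std_word w -> uniq (positions w).
Proof.
move=> sw; rewrite map_inj_in_uniq ?iota_uniq // => i j.
rewrite !mem_iota (std_size sw) !add1n !ltnS -!(std_mem _ sw) => iw jw e.
have [li lj] : index i w < n /\ index j w < n by rewrite -(std_size sw) !index_mem.
rewrite -(nth_index 0 iw) -(nth_index 0 jw); congr nth; move: li lj e; clear; lia.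
Qed.

Lemma positions_inj w w' : std_word w -> std_word w' -> positions w = positions w' -> w = w'.
Proof.
move=> sw sw'; rewrite /positions (std_size sw) (std_size sw') => /eq_in_map e.
apply: (@eq_from_nth _ 0); rewrite (std_size sw) ?(std_size sw') // => k kn.
have kw : nth 0 w k \in w by rewrite mem_nth // (std_size sw).
have := kw; rewrite (std_mem _ sw) => kr.
have ki : index (nth 0 w k) w = k by rewrite index_uniq ?(std_size sw) ?(std_uniq sw).
have := e (nth 0 w k); rewrite mem_iota add1n ltnS => /(_ kr).
have lk' : index (nth 0 w k) w' < n by rewrite -(std_size sw') index_mem (std_mem _ sw').
rewrite ki => ee; rewrite -[LHS](nth_index 0 (_ : nth 0 w k \in w')) ?(std_mem _ sw') //.
by congr nth; move: ee lk' kn; clear; lia.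
Qed.

Lemma positions_split w i : std_word w -> 1 < i < n ->
  exists s r, size s = i - 2 /\ forall w', size w' = n ->
    (forall j, j != i.-1 -> j != i -> j != i.+1 -> index j w' = index j w) ->
    positions w' = s ++ [:: n - index i.-1 w'; n - index i w'; n - index i.+1 w'] ++ r.
Proof.
move=> sw /andP[i1 ilt].
exists [seq n - index j w | j <- iota 1 (i - 2)], [seq n - index j w | j <- iota i.+2 (n -
  i.+1)].
split; first by rewrite size_map size_iota.
move=> w' sw' ej; rewrite /positions sw'.
have ni : n = (i - 2) + (3 + (n - i.+1)) by move: i1 ilt; clear; lia.
rewrite [in iota 1 n]ni !iotaD !map_cat; congr (_ ++ _).
  apply/eq_in_map => j; rewrite mem_iota => ji; congr (_ - _); apply: ej; move: ji i1;
    clear; lia.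
have -> : 1 + (i - 2) = i.-1 by move: i1; clear; lia.
congr (_ ++ _); first by case: (i) i1 => [|[|]].
have -> : i.-1 + 3 = i.+2 by move: i1; clear; lia.
by apply/eq_in_map => j; rewrite mem_iota => ji; congr (_ - _); apply: ej; move: ji i1;
  clear; lia.
Qed.

Lemma index_swap a b j w : a != b ->
  index j (swap a b w) = index ([fun x => x with a |-> b, b |-> a] j) w.
Proof.
move=> ab; set f := [fun x => x with a |-> b, b |-> a].
have fK : involutive f.
  move=> x /=; case: (eqVneq x a) => [->|xa]; first by rewrite eqxx eq_sym (negbTE ab).
  by case: (eqVneq x b) => [->|xb]; rewrite ?eqxx // (negbTE xa) (negbTE xb).
by rewrite -[in LHS](fK j) /swap index_map //; apply: inv_inj.
Qed.

Lemma size_dual_equiv i w : size (dual_equiv i w) = size w.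
Proof. by rewrite /dual_equiv; do 2?[case: ifP => _] => //; rewrite size_map. Qed.

(** Letters are counted from 1 and places from 0, so the first of the letters [i.-1], [i], [i.+1] is
    at place [i - 2]. *)
Lemma positions_dual w i : std_word w -> 1 < i < n ->
  positions (dual_equiv i w) = dmove (i - 2) (positions w).
Proof.
move=> sw iin; have [s [r [ss spl]]] := positions_split sw iin.
have sz : size (dual_equiv i w) = n by rewrite size_dual_equiv (std_size sw).
have e1 := spl w (std_size sw) (fun _ _ _ _ => erefl).
have [m1 m2 m3] : [/\ i.-1 \in w, i \in w & i.+1 \in w].
  by rewrite !(std_mem _ sw); split; move: iin; clear; lia.
have ne j k : j != k -> j \in w -> index j w != index k w.
  move=> jk jw; apply: contraNneq jk => e.
  have kw : k \in w by rewrite -index_mem -e index_mem.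
  by rewrite -(nth_index 0 jw) e nth_index.
have lt j : j \in w -> index j w < n by rewrite -(std_size sw) index_mem.
have [a1 a2 a3] := And3 (lt _ m1) (lt _ m2) (lt _ m3).
have n12 : index i.-1 w != index i w by apply: ne => //; move: iin; clear; lia.
have n13 : index i.-1 w != index i.+1 w by apply: ne => //; move: iin; clear; lia.
have n23 : index i w != index i.+1 w by apply: ne => //; move: iin; clear; lia.
have j12 : ((i.-1 == i) = false) * ((i == i.-1) = false) by split; move: iin; clear; lia.
have j13 : ((i.-1 == i.+1) = false) * ((i.+1 == i.-1) = false) by split; move: iin; clear; lia.
have j23 : ((i == i.+1) = false) * ((i.+1 == i) = false) by split; move: iin; clear; lia.
rewrite e1 -{1}[i - 2]addn0 -{1}ss dmove_cat /= (spl _ sz) => [|j ji1 ji ji3].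
  congr (s ++ _ ++ r); rewrite /move3 /dual_equiv.
  case: ifP => b1; last case: ifP => b2.
  - rewrite ifT //; move: b1 n12 n13 n23 a1 a2 a3; rewrite /between; clear; lia.
  - rewrite !index_swap /= ?eqxx ?j12 ?j13 ?j23 //.
    rewrite ifF; last by move: b1 b2 n12 n13 n23 a1 a2 a3; rewrite /between; clear; lia.
    by rewrite ifF //; move: b1 b2 n12 n13 n23 a1 a2 a3; rewrite /between; clear; lia.
  - rewrite !index_swap /= ?eqxx ?j12 ?j13 ?j23 //.
    rewrite ifF; last by move: b1 b2 n12 n13 n23 a1 a2 a3; rewrite /between; clear; lia.
    by rewrite ifT //; move: b1 b2 n12 n13 n23 a1 a2 a3; rewrite /between; clear; lia.
rewrite /dual_equiv; case: ifP => // _; case: ifP => _; rewrite index_swap ?j12 ?j23 //=.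
  by rewrite (negbTE ji) (negbTE ji3).
by rewrite (negbTE ji) (negbTE ji1).
Qed.
End Word.

(** * Tableaux of lattice words *)

Lemma perm_filter_flatten (T : eqType) (f : T -> nat) (s : seq T) R :
  perm_eq (flatten [seq [seq x <- s | f x == r] | r <- iota 0 R]) [seq x <- s | f x < R].
Proof.
elim: R => [|R IH]; first by rewrite (eq_filter (a2 := pred0)) ?filter_pred0.
rewrite -addn1 iotaD map_cat flatten_cat /= cats0 add0n.
rewrite perm_sym -(perm_filterC (fun x => f x < R)) -!filter_predI.
rewrite (@eq_filter _ (predI _ _) (fun x => f x < R)); last by move=> x /=; lia.
rewrite (@eq_filter _ (predI _ _) (fun x => f x == R)); last by move=> x /=; lia.
by rewrite perm_cat2r perm_sym.
Qed.

Lemma sorted_iota (e : rel nat) a k : (forall r, e r r.+1) -> sorted e (iota a k).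
Proof.
by move=> er; case: k => //= k; elim: k a => //= k IH a; rewrite er IH.
Qed.

(** This makes columns increase, with [P] for row [r.+1] and [Q] for row [r]. Before the [i]-th
    element [j] of [P] there are [i] elements of [P], hence more than [i] of [Q]. *)
Lemma nth_filter_iota (P Q : pred nat) n i :
  i < size [seq j <- iota 0 n | P j] -> i < size [seq j <- iota 0 n | Q j] ->
  (forall j, j < n -> P j -> count P (iota 0 j) < count Q (iota 0 j)) ->
  nth 0 [seq j <- iota 0 n | Q j] i < nth 0 [seq j <- iota 0 n | P j] i.
Proof.
move=> iP iQ H; set j := nth 0 [seq j <- iota 0 n | P j] i.
have : j \in [seq j <- iota 0 n | P j] by apply: mem_nth.
rewrite mem_filter mem_iota => /andP[Pj /= jn].
have spl (A : pred nat) : [seq k <- iota 0 n | A k] =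
    [seq k <- iota 0 j | A k] ++ [seq k <- iota j (n - j) | A k].
  by rewrite -filter_cat -iotaD subnKC // ltnW.
have ci : count P (iota 0 j) = i.
  have sP : size [seq k <- iota 0 j | P k] < size [seq k <- iota 0 n | P k].
    by rewrite spl size_cat -subnSK //= Pj /= addnS ltnS leq_addr.
  rewrite -size_filter; apply/eqP.
  rewrite -(nth_uniq 0 sP iP); last by rewrite filter_uniq ?iota_uniq.
  by rewrite -/j {1}spl nth_cat ltnn subnn -subnSK //= Pj.
have := H j jn Pj; rewrite ci -size_filter => lt.
rewrite spl nth_cat lt.
by have := mem_nth 0 lt; rewrite mem_filter mem_iota => /andP[_].
Qed.

Definition nrows (t : seq nat) : nat := \max_(x <- t) x.+1.

Definition row (t : seq nat) (r : nat) : seq nat :=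
  [seq j.+1 | j <- iota 0 (size t) & nth 0 t j == r].

Definition tab (t : seq nat) : seq (seq nat) := [seq row t r | r <- iota 0 (nrows t)].

Lemma count_nth_iota t r j : j <= size t ->
  count (fun i => nth 0 t i == r) (iota 0 j) = cnt r (take j t).
Proof. by move=> js; rewrite /cnt -(map_nth_iota0 0 js) count_map. Qed.

Lemma size_row t r : size (row t r) = cnt r t.
Proof. by rewrite size_map size_filter count_nth_iota // take_size. Qed.

Lemma shape_tab t : shape (tab t) = [seq cnt r t | r <- iota 0 (nrows t)].
Proof. by rewrite /shape /tab -map_comp; apply: eq_map => r /=; rewrite size_row. Qed.

Lemma nrows_perm t t' : perm_eq t t' -> nrows t = nrows t'.
Proof. exact: perm_big. Qed.

Lemma shape_tab_perm t t' : perm_eq t t' -> shape (tab t) = shape (tab t').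
Proof.
by move=> pe; rewrite !shape_tab (nrows_perm pe); apply: eq_map => r; apply: cnt_perm.
Qed.

Lemma perm_tab t : perm_eq (flatten (tab t)) (iota 1 (size t)).
Proof.
have -> : tab t = map (map succn) [seq [seq j <- iota 0 (size t) | nth 0 t j == r] | r <-
  iota 0 (nrows t)].
  by rewrite -map_comp.
rewrite -map_flatten -[1]/(0.+1) -add1n iotaDl; apply: perm_map.
rewrite (permPl (perm_filter_flatten _ _ _)) (eq_in_filter (a2 := predT)) ?filter_predT //.
move=> j; rewrite mem_iota /= => jt.
by apply: (leq_bigmax_seq (F := succn)); rewrite ?mem_nth.
Qed.

Lemma cnt_mono t x y : yam t -> x <= y -> cnt y t <= cnt x t.
Proof.
move=> yt /subnKC <-; elim: (y - x) => [|k IH]; first by rewrite addn0.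
by rewrite addnS (leq_trans (yam_cnt _ yt)).
Qed.

Lemma tab_partition t : yam t -> is_partition (shape (tab t)).
Proof.
move=> yt; rewrite /is_partition shape_tab sorted_map; apply/andP; split.
  by apply: sorted_iota => r /=; apply: yam_cnt.
apply/negP => /mapP[r]; rewrite mem_iota /= => rn c0.
have [x xt rx] : exists2 x, x \in t & r <= x.
  apply/hasP; apply: contraLR rn => /hasPn H; rewrite -leqNgt.
  by apply/bigmax_leqP_seq => x xt _; have := H x xt; rewrite -ltnNge.
have := cnt_mono yt rx; rewrite -c0 leqNgt => /negP; apply.
by rewrite /cnt -has_count has_pred1.
Qed.

Lemma yam_nth t j : yam t -> j < size t -> addable (nth 0 t j) (take j t).
Proof.
move=> yt jt; move: yt; rewrite -{1}(cat_take_drop j t) yam_cat (drop_nth 0 jt) /=.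
by case/and3P.
Qed.

Lemma tab_syt t : yam t -> is_syt (shape (tab t)) (tab t).
Proof.
move=> yt; rewrite /is_syt eqxx /= -size_flatten (perm_size (perm_tab t)) size_iota perm_tab /=.
apply/andP; split.
  apply/allP => _ /mapP[r _ ->]; rewrite /row sorted_map.
  apply: (sorted_filter (leT := ltn)); last exact: iota_ltn_sorted.
  by move=> a b c; apply: ltn_trans.
rewrite sorted_map; apply: sorted_iota => r /=; apply/(all_nthP (0, 0)) => i iz.
rewrite nth_zip_cond iz /=; move: iz; rewrite size_zip leq_min => /andP[i1 i2].
rewrite !size_map in i1 i2; rewrite /row !(nth_map 0) // ltnS.
apply: nth_filter_iota => // j jt /eqP ej; rewrite !count_nth_iota ?(ltnW jt) //.
by have := yam_nth yt jt; rewrite ej.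
Qed.

(** The reading order of the letters of [tab t]: higher rows first, then smaller letters. *)
Definition before (t : seq nat) : rel nat :=
  [rel a b | (nth 0 t b.-1 < nth 0 t a.-1) || (nth 0 t a.-1 == nth 0 t b.-1) && (a < b)].

Lemma before_trans t : transitive (before t).
Proof.
move=> b a c; rewrite /before /= => /orP[lt1|/andP[/eqP e1 l1]] /orP[lt2|/andP[/eqP e2 l2]].
- by rewrite (ltn_trans lt2 lt1).
- by rewrite -e2 lt1.
- by rewrite e1 lt2.
- by rewrite e1 e2 eqxx (ltn_trans l1 l2) orbT.
Qed.

Lemma mem_row t r a : (a \in row t r) = (0 < a <= size t) && (nth 0 t a.-1 == r).
Proof.
apply/mapP/idP => [[j]|/andP[]].
  by rewrite mem_filter mem_iota => /andP[/= /eqP <- lt] ->; rewrite /= lt eqxx.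
by case: a => //= a lt e; exists a; rewrite // mem_filter e mem_iota.
Qed.

Lemma reading_sorted t : sorted (before t) (reading_word (tab t)).
Proof.
rewrite sorted_pairwise; last exact: before_trans.
rewrite /reading_word /tab -map_rev.
have : pairwise gtn (rev (iota 0 (nrows t))).
  rewrite -sorted_pairwise; last by move=> a b c /= ba cb; apply: ltn_trans ba.
  by rewrite rev_sorted; apply: iota_ltn_sorted.
elim: (rev _) => //= r rs IH /andP[/allP lt /IH]; rewrite pairwise_cat => ->.
rewrite andbT; apply/andP; split.
  apply/allrelP => a b; rewrite mem_row => /andP[_ /eqP ea] /flattenP[_ /mapP[r' /lt r'r ->]].
  by rewrite mem_row => /andP[_ /eqP eb]; rewrite /before /= ea eb [_ < _]r'r.
rewrite -sorted_pairwise; last exact: before_trans.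
apply: (@sub_in_sorted _ [in row t r] ltn).
- by move=> a b; rewrite /= !mem_row /before /= => /andP[_ /eqP->] /andP[_ /eqP->] ->;
    rewrite eqxx orbT.
- by apply/allP.
rewrite /row sorted_map; apply: (sorted_filter (leT := ltn)); last exact: iota_ltn_sorted.
by move=> a b c; apply: ltn_trans.
Qed.

Lemma std_reading t : std_word (size t) (reading_word (tab t)).
Proof.
by apply: perm_trans (perm_tab t); apply: perm_flatten; rewrite perm_rev.
Qed.

Lemma before_index t a b : a != b -> 0 < a <= size t -> 0 < b <= size t ->
  (index a (reading_word (tab t)) < index b (reading_word (tab t))) = before t a b.
Proof.
set w := reading_word _ => ab a1 b1.
have [aw bw] : a \in w /\ b \in w by rewrite !(std_mem _ (std_reading t)).
have H := sorted_ltn_index (@before_trans t) (reading_sorted t).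
apply/idP/idP => [|bab]; first exact: H.
case: ltngtP => // [lt|e]; last first.
  by move/eqP: ab; case; rewrite -(nth_index 0 aw) e nth_index.
have := before_trans bab (H _ _ bw aw lt).
by rewrite /before /= ltnn eqxx ltnn.
Qed.

Lemma swap_sym a b w : swap a b w = swap b a w.
Proof.
apply: eq_map => x /=; case: (eqVneq x a) => [->|//].
by case: (eqVneq a b) => // ->.
Qed.

Lemma swap_lt j a b : a < b -> (a, b) != (j, j.+1) ->
  [fun x => x with j |-> j.+1, j.+1 |-> j] a < [fun x => x with j |-> j.+1, j.+1 |-> j] b.
Proof.
rewrite xpair_eqE /= => lt.
case: (eqVneq a j) => ?; case: (eqVneq b j) => ?; case: (eqVneq a j.+1) => ?;
  case: (eqVneq b j.+1) => ?; rewrite /=; lia.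
Qed.

(** Both words have the same letters and are sorted for [before t']. Renaming consecutive letters in
    different rows preserves the order inside every row. *)
Lemma reading_swap t t' j : size t' = size t -> j.+1 < size t ->
  nth 0 t' j = nth 0 t j.+1 -> nth 0 t' j.+1 = nth 0 t j ->
  (forall i, i != j -> i != j.+1 -> nth 0 t' i = nth 0 t i) ->
  nth 0 t j != nth 0 t j.+1 ->
  reading_word (tab t') = swap j.+1 j.+2 (reading_word (tab t)).
Proof.
move=> st jt e1 e2 e3 ne; set f := [fun x => x with j.+1 |-> j.+2, j.+2 |-> j.+1].
have jj : (j.+2 == j.+1) = false by rewrite gtn_eqF.
have fK : involutive f.
  move=> x /=; case: (eqVneq x j.+1) => [->|xa]; first by rewrite eqxx jj.
  by case: (eqVneq x j.+2) => [->|xb]; rewrite ?eqxx // (negbTE xa) (negbTE xb).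
apply: (irr_sorted_eq (@before_trans t')).
- by move=> a; rewrite /before /= ltnn eqxx ltnn.
- exact: reading_sorted.
- rewrite /swap sorted_map; apply: (@sub_in_sorted _ [pred a | 0 < a] (before t)).
  + have fE a : 0 < a -> nth 0 t' (f a).-1 = nth 0 t a.-1.
      case: a => //= a _; rewrite !eqSS; case: (eqVneq a j) => [->//|aj].
      by case: (eqVneq a j.+1) => [->//|aj1] /=; apply: e3.
    move=> a b a0 b0; rewrite /before /= in a0 b0 *; rewrite !fE //.
    case/orP => [->//|/andP[/eqP e lt]]; rewrite e ltnn eqxx /=.
    apply: swap_lt lt _; apply: contraNneq ne => -[ea eb].
    by move: e; rewrite ea eb /= => ->.
  + by apply/allP => a; rewrite (std_mem _ (std_reading t)) => /andP[].
  + exact: reading_sorted.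
move=> a; rewrite (std_mem _ (std_reading t')) st -[a in RHS]fK mem_map; last exact: inv_inj.
rewrite (std_mem _ (std_reading t)) /=; case: (eqVneq a j.+1) => [->|?].
  by rewrite /= jt ltnW.
by case: (eqVneq a j.+2) => [->|//] /=; rewrite jt ltnW.
Qed.

Lemma reading_dmove t c : c.+2 < size t ->
  reading_word (tab (dmove c t)) = dual_equiv c.+2 (reading_word (tab t)).
Proof.
move=> ct; have : size (drop c t) > 2 by rewrite size_drop; move: ct; clear; lia.
case e : (drop c t) => [|x [|y [|z r]]] // _.
have ss : size (take c t) = c by rewrite size_takel //; move: ct; clear; lia.
have et : t = take c t ++ [:: x, y, z & r] by rewrite -e cat_take_drop.
set s := take c t in ss et.
have nt k : nth 0 t (c + k) = nth 0 [:: x, y, z & r] k.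
  by rewrite et nth_cat -ss ltnNge leq_addr /= addKn.
have [nx [ny nz]] : nth 0 t c = x /\ nth 0 t c.+1 = y /\ nth 0 t c.+2 = z.
  by have := nt 0; have := nt 1; have := nt 2; rewrite addn0 addn1 addn2.
have ix a b : a != b -> a < 3 -> b < 3 -> (index (c + a).+1 (reading_word (tab t)) <
    index (c + b).+1 (reading_word (tab t))) = before t (c + a).+1 (c + b).+1.
  by move=> ab a3 b3; apply: before_index; move: ab a3 b3 ct; clear; lia.
have i01 := ix 0 1 isT isT isT; have i10 := ix 1 0 isT isT isT.
have i02 := ix 0 2 isT isT isT; have i20 := ix 2 0 isT isT isT.
have i12 := ix 1 2 isT isT isT; have i21 := ix 2 1 isT isT isT.
rewrite /before /= !nt /= !addn0 !addn1 !addn2 in i01 i10 i02 i20 i12 i21.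
have dt : dmove c t = s ++ move3 x y z ++ r by rewrite [in LHS]et dmove_end.
have nd k : nth 0 (dmove c t) (c + k) = nth 0 (move3 x y z ++ r) k.
  by rewrite dt nth_cat -ss ltnNge leq_addr /= addKn.
have far k : k < c \/ c + 3 <= k -> nth 0 (dmove c t) k = nth 0 t k.
  rewrite dt [in RHS]et !nth_cat ss => -[kc|ck]; first by rewrite kc.
  rewrite ltnNge (leq_trans (leq_addr 3 c) ck) /=.
  have -> : k - c = (k - c - 3).+3 by move: ck; clear; lia.
  by rewrite (perm_size (perm_move3 x y z)) /= !subSS subn0.
have [dx dy dz] := And3 (nd 0) (nd 1) (nd 2); rewrite addn0 addn1 addn2 in dx dy dz.
have b1 : between (index c.+1 (reading_word (tab t))) (index c.+2 (reading_word (tab t)))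
    (index c.+3 (reading_word (tab t))) = ((y <= x) == (z <= y)).
  by rewrite /between i01 i12 i10 i21; move: (x) (y) (z); clear; lia.
have b2 : between (index c.+2 (reading_word (tab t))) (index c.+1 (reading_word (tab t)))
    (index c.+3 (reading_word (tab t))) = ((y <= x) != (z <= x)).
  by rewrite /between i02 i20 i10 i01; move: (x) (y) (z); clear; lia.
rewrite /dual_equiv b1 b2; rewrite /move3 in dt dx dy dz.
case: ifP dt dx dy dz => [_ -> _ _ _|c1]; first by rewrite -et.
case: ifP => [/eqP c2|c2] dt dx dy dz; rewrite ?c2 ?eqxx /=.
  rewrite swap_sym; apply: reading_swap; rewrite ?size_dmove ?nx ?ny //.
  - by apply: ltnW.
  - move=> i i1 i2; case: (eqVneq i c.+2) => [->|i3]; first by rewrite dz nz.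
    by apply: far; move: i1 i2 i3; clear; lia.
  - by apply: contraFneq c1 => exy; rewrite exy leqnn eq_sym; move: c2; rewrite exy leqnn;
      case: (z <= y).
apply: reading_swap; rewrite ?size_dmove ?ny ?nz //.
  move=> i i1 i2; case: (eqVneq i c) => [->|i3]; first by rewrite dx nx.
  by apply: far; move: i1 i2 i3; clear; lia.
by apply: contraFneq c1 => eyz; move: c2; rewrite eyz leqnn => c2; move: c2; case: (z <= x).
Qed.

(** * Translation to signed colored graphs *)

Lemma syt_word lam (T : syt lam) :
  is_syt lam (val T) /\ std_word (sumn lam) (reading_word (val T)).
Proof.
have := valP T; rewrite mem_syt_seq => sT; split=> //.
case/and4P: sT => _ pT _ _; apply: perm_trans pT.
by apply: perm_flatten; rewrite perm_rev.
Qed.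

Lemma reading_inj lam t u : is_syt lam t -> is_syt lam u ->
  reading_word t = reading_word u -> t = u.
Proof.
case/and4P=> /eqP st _ _ _ /and4P[/eqP su _ _ _] e.
apply: (can_inj revK); apply: eq_from_flatten_shape => //.
by rewrite /shape !map_rev -/(shape t) -/(shape u) st su.
Qed.

Lemma inj_surj_bij (aT rT : finType) (f : aT -> rT) : injective f ->
  (forall y, exists x, f x = y) -> bijective f.
Proof.
move=> fi fs; have [h hK] := fin_all_exists fs; exists h => //.
by move=> x; apply: fi; rewrite hK.
Qed.

Lemma tab_inj t t' : size t = size t' -> tab t = tab t' -> t = t'.
Proof.
move=> st et; apply: (@eq_from_nth _ 0) => // j jt.
have en : nrows t = nrows t'.
  by rewrite -[LHS](size_iota 0) -[RHS](size_iota 0) -[LHS](size_map (row t)) -/(tab t) et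
    size_map.
have rn : nth 0 t j < nrows t by apply: (leq_bigmax_seq (F := succn)); rewrite ?mem_nth.
have rowE u : nth 0 t j < nrows u -> nth [::] (tab u) (nth 0 t j) = row u (nth 0 t j).
  by move=> lt; rewrite (nth_map 0) ?size_iota // nth_iota.
have : j.+1 \in row t (nth 0 t j) by rewrite mem_row /= jt eqxx.
by rewrite -rowE // et rowE -?en // mem_row /= => /andP[_ /eqP].
Qed.

Section Translation.
Variables (m n N : nat) (G : scgraph m n N).

Definition colour (c : nat) : nat := c + m.+1.

Definition neighbour (c : nat) (v : G) : G :=
  if [pick w | edge (colour c) v w] is Some w then w else v.

Definition sign (v : G) (h : nat) : bool := sgn v (h + m).

(** The letters are [m], ..., [n]; for [n <= m] truncated subtraction leaves one letter and no
    colour. *)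
Definition letters : nat := (n - m).+1.

Lemma neighbourP c v : neighbour c v != v -> edge (colour c) v (neighbour c v).
Proof. by rewrite /neighbour; case: pickP => //= _; rewrite eqxx. Qed.

(** * Component sizes from the local axioms *)

Section Local.
Variables (a b d k B : nat) (v : G).
Hypotheses (bnd : orbits_bounded k B) (loc : locally_syt G a b)
  (ad : a <= d + m) (db : d + m + k < b) (m_gt0 : 0 < m).
Let window : pred nat := fun x => d <= x < d + k.
Let H := restrict a b G.

Lemma connected_step (w : G) c : window c -> connected (v : H) (w : H) ->
  connected (v : H) (neighbour c w : H).
Proof.
move=> dc vw; case: (eqVneq (neighbour c w) w) => [->//|ne].
have col : a < colour c < b by move: dc ad db; rewrite /window /colour; clear; lia.
apply: connect_trans vw (connect1 _); apply/existsP.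
case/andP: (col) => _ cb; exists (Ordinal cb).
by rewrite /= /restrict_edge /= col neighbourP.
Qed.

(** The isomorphism preserves colours, so a walk in the window becomes a sequence of moves on the
    positions of a reading word. Distinct vertices give distinct tableaux, hence distinct words, and
    [orbit_size] bounds their number. *)
Lemma local_bound : reach_bounded neighbour window v B.
Proof.
move=> s us sr; have [lam [T [_ bn [f [fb fe]]]]] := loc v.
pose x0 : component (v : H) := exist (fun w : H => connected (v : H) w) (v : H) (connect0 _ _).
pose inj (w : G) : component (v : H) := insubd x0 (w : H).
have injK w : connected (v : H) (w : H) -> val (inj w) = w by move=> vw; rewrite insubdK.
pose tabl (w : G) : syt lam := val (f (inj w)).
pose P w := positions (reading_word (val (tabl w))).
have std w : std_word (sumn lam) (reading_word (val (tabl w))) by have [] := syt_word (tabl w).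
have step w c : window c -> connected (v : H) (w : H) ->
    P (neighbour c w) = P w \/ P (neighbour c w) = dmove (c + m.-1) (P w).
  move=> dc vw; have vw' := connected_step dc vw.
  case: (eqVneq (neighbour c w) w) => [->|ne]; [by left | right].
  have col : a < colour c < b by move: dc ad db; rewrite /window /colour; clear; lia.
  have : edge (colour c) (inj w) (inj (neighbour c w)).
    by rewrite /= /component_edge /= !injK //= /restrict_edge /= col neighbourP.
  rewrite -fe /= /component_edge /= /restrict_edge /= => /andP[_ /and3P[rng _ /orP e]].
  have -> : c + m.-1 = colour c - 2 by move: m_gt0; rewrite /colour; clear; lia.
  pose rw u := reading_word (val (tabl u)).
  (* An edge says that one of the two words is the dual of the other; as [dmove] is an involution,
     either case gives the same relation. *)
  case: e => /eqP e; rewrite /P -!/(rw _).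
    have -> : rw (neighbour c w) = dual_equiv (colour c) (rw w) := e.
    exact: (positions_dual (std w) rng).
  have -> : rw w = dual_equiv (colour c) (rw (neighbour c w)) := e.
  by rewrite (positions_dual (std _) rng) dmoveK.
have walk cs : all window cs -> connected (v : H) (run neighbour v cs : H) /\
    exists2 cs', all (fun c => d + m.-1 <= c < d + m.-1 + k) cs' &
      P (run neighbour v cs) = run dmove (P v) cs'.
  elim/last_ind: cs => [_|cs c IH]; first by split; [apply: connect0 | exists [::]].
  rewrite all_rcons run_rcons => /andP[dc /IH[vw [cs' ok' e]]].
  split; first exact: connected_step.
  case: (step _ _ dc vw) => ->; first by exists cs'.
  exists (rcons cs' (c + m.-1)); last by rewrite run_rcons e.
  by rewrite all_rcons ok' andbT; move: dc; rewrite /window; clear; lia.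
have sconn w : w \in s -> connected (v : H) (w : H) by move=> /sr[cs /walk[vw _] ->].
have Pinj : {in s &, injective P}.
  move=> w w' ws ws' /(positions_inj (std w) (std w')) e.
  have {}e : tabl w = tabl w'.
    have [tw tw'] := ((syt_word (tabl w)).1, (syt_word (tabl w')).1).
    by apply: val_inj; apply: reading_inj tw tw' e.
  have /(bij_inj fb) e2 : f (inj w) = f (inj w') by apply: val_inj.
  by rewrite -(injK w) ?sconn // e2 injK ?sconn.
rewrite -(size_map P).
have up : uniq (P v) by apply: positions_uniq (std v).
apply: (orbit_size (e := d + m.-1) bnd up).
- rewrite size_map size_iota (std_size (std v)); apply: leq_trans bn.
  by move: db m_gt0; clear; lia.
- by rewrite map_inj_in_uniq.
- by move=> _ /mapP[w /sr[cs /walk[_ [cs' ok' e]] ->] ->]; exists cs'.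
Qed.
End Local.

Hypotheses (m_gt0 : 0 < m) (le_nN : n <= N).
Hypotheses (A1 : axiom1 G) (A2 : axiom2 G) (A3 : axiom3 G) (A5 : axiom5 G).

Lemma colour_lt c : (c.+2 < letters) = (m < colour c < n).
Proof. by rewrite /letters /colour; lia. Qed.

Lemma edgeE c v w : edge (colour c) v w = (neighbour c v == w) && (v != w).
Proof.
apply/idP/andP => [e|[/eqP <- ne]]; last by apply: neighbourP; rewrite eq_sym.
split; last by apply: contraTneq e => ->; rewrite edge_irr.
have [/(_ v w e) ad /(_ v ad)[w' [_ uw]]] := A1 (edge_range e).
rewrite /neighbour; case: pickP => [u e'|/(_ w)]; last by rewrite e.
by rewrite -(uw _ e) (uw _ e').
Qed.

Lemma neighbourK c : involutive (neighbour c).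
Proof.
move=> v; case: (eqVneq (neighbour c v) v) => [e|ne]; first by rewrite e.
have := neighbourP ne; rewrite edge_sym edgeE => /andP[/eqP-> _]; by [].
Qed.

Lemma neighbour_fixed c v : c.+2 < letters ->
  (neighbour c v == v) = (sign v c == sign v c.+1).
Proof.
rewrite colour_lt => cn; have [ad ex] := A1 cn.
have adE : admits v (colour c) = (sign v c != sign v c.+1).
  rewrite /admits /sign /colour addnS /= addSn; by case: (sgn v (c + m)); case: sgn.
apply/idP/idP => [/eqP e|]; [apply: contraT|apply: contraTT].
  rewrite -adE => /ex[w [/[swap] _]]; rewrite edgeE e => /andP[/eqP->].
  by rewrite eqxx.
by move=> /neighbourP/ad; rewrite adE.
Qed.

Lemma sign_far c v h : h.+1 < letters -> (h.+1 < c) || (c.+2 < h) ->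
  sign (neighbour c v) h = sign v h.
Proof.
move=> hL ch; case: (eqVneq (neighbour c v) v) => [->//|/neighbourP/A2[_ _]].
move=> H; apply/esym/H.
  by move: m_gt0 le_nN hL; rewrite /letters; clear; lia.
by move: ch; rewrite /colour; clear; lia.
Qed.

Lemma neighbour_comm c c' v : c.+2 < c' -> c'.+2 < letters ->
  neighbour c (neighbour c' v) = neighbour c' (neighbour c v).
Proof.
move=> cc cL; have cL' : c.+2 < letters by move: cc cL; clear; lia.
case: (eqVneq (neighbour c v) v) => [e|ne].
  rewrite e; apply/eqP; rewrite neighbour_fixed // !sign_far -?neighbour_fixed ?e //;
    by move: cc cL; clear; lia.
case: (eqVneq (neighbour c' v) v) => [e|ne'].
  rewrite e; apply/esym/eqP; rewrite neighbour_fixed // !sign_far -?neighbour_fixed ?e //;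
    by move: cc cL; clear; lia.
have e1 := neighbourP ne; have e2 := neighbourP ne'; rewrite edge_sym in e1.
have [|y [e3 e4]] := A5 _ e1 e2; first by move: cc; rewrite /colour; clear; lia.
by move: e3 e4; rewrite !edgeE => /andP[/eqP-> _] /andP[/eqP-> _].
Qed.

Lemma admits_sign (v : G) c : admits v (colour c) = (sign v c != sign v c.+1).
Proof. by rewrite /admits /sign /colour addnS addSn /=; case: (sgn v (c + m)); case: sgn. Qed.

Lemma translate :
  (forall d v, d.+3 < letters -> reach_bounded neighbour (fun x => d <= x < d + 2) v 3) ->
  (forall d v, d.+4 < letters -> reach_bounded neighbour (fun x => d <= x < d + 3) v 6) ->
  dual_graph neighbour sign letters.
Proof.
move=> s2 s3; split=> //.
- by move=> c v _; apply: neighbourK.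
- exact: neighbour_fixed.
- move=> c v _ /neighbourP/A2[h1 h2 _].
  rewrite /sign; move: h1 h2; rewrite /colour addnS /= addSn => -> ->.
  by rewrite !negbK.
- by move=> c v h _; apply: sign_far.
- move=> c v cL /neighbourP/A3[+ _]; rewrite [_.-1](_ : _ = colour c);
    last by rewrite /colour addSn.
  rewrite !admits_sign => H; apply/orP; apply: H.
  by move: m_gt0; rewrite /colour; clear; lia.
- move=> c v cL /neighbourP/A3[_]; rewrite [_.+1](_ : _ = colour c.+1);
    last by rewrite /colour addSn.
  rewrite !admits_sign => H; apply/orP; apply: H.
  by move: cL le_nN; rewrite /letters /colour; clear; lia.
- exact: neighbour_comm.
Qed.

Lemma axiom6E : axiom6 G <-> forall c, c.+2 < letters -> few_top neighbour c.
Proof.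
have K c u : lower c.+3 u = (u <= c) by rewrite /lower !ltnS.
have connE c v w : m < colour c < n ->
    @connected m (colour c).+1 (restrict m (colour c).+1 G) v w <-> reach neighbour (lower
      c.+3) v w.
  move=> cn; split=> [/connectP[p]|[cs]].
    elim: p v => [|u p IH] v /=; first by move=> _ ->; apply: reach_refl.
    move=> /andP[/existsP[i /andP[/andP[mi ic] e]] /IH{}IH] /IH{}IH.
    have [d id] : exists d, i = colour d :> nat.
      by exists (i - m.+1); rewrite /colour subnK.
    apply: reach_trans IH; rewrite /= id edgeE in e; case/andP: e => /eqP <- _.
    by apply: reach1; rewrite K; move: ic; rewrite id /colour; clear; lia.
  elim/last_ind: cs w => [|cs d IH] w; first by move=> _ ->; apply: connect0.
  rewrite all_rcons run_rcons K => /andP[dc ok] ->.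
  apply: connect_trans (IH _ ok erefl) _.
  set u := run _ _ _; case: (eqVneq (neighbour d u) u) => [->|ne]; first exact: connect0.
  have dl : colour d < (colour c).+1 by move: dc; rewrite /colour; clear; lia.
  apply: connect1; apply/existsP; exists (Ordinal dl).
  by rewrite /= /restrict_edge /= dl neighbourP // andbT /colour addnS ltnS leq_addl.
have colour_inj d d' : (colour d == colour d') = (d == d') by rewrite /colour eqn_add2r.
split=> [A6 c cL v w vw|few i mi v w vw].
  have cn := cL; rewrite colour_lt in cn.
  have [p wp cp] := A6 _ cn v w ((connE c v w cn).2 vw).
  suff [cs [ok ec ew]] : exists cs, [/\ all (lower c.+3) cs,
      count_mem c cs = count (fun s => s.1 == colour c) p & w = run neighbour v cs].
    by exists cs; rewrite ec.
  elim: p v wp {cp vw} => [|[i u] p IH] v /=; first by move=> /eqP <-; exists [::].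
  move=> /andP[/andP[/andP[mi ic] e] /IH[cs [ok ct ew]]].
  have id : i = colour (i - m.+1) by rewrite /colour subnK.
  rewrite {}id in ic e *; set d := i - m.+1 in ic e *.
  rewrite edgeE in e; case/andP: e => /eqP eu _.
  exists (d :: cs); rewrite /= ok ct K andbT colour_inj eu.
  by split=> //; move: ic; rewrite /colour; clear; lia.
have [c ic] : exists c, i = colour c.
  by exists (i - m.+1); rewrite /colour subnK //; case/andP: mi.
subst i; have cL := mi; rewrite -colour_lt in cL.
have [cs [ok ct ew]] := few c cL v w ((connE c v w mi).1 vw).
suff [p wp cp] : exists2 p, @is_walk m (colour c).+1 (restrict m (colour c).+1 G) v p w &
    count (fun s => s.1 == colour c) p <= count_mem c cs.
  by exists p => //; apply: leq_trans ct.
elim: cs v ok ew {ct vw} => [|d cs IH] v /=; first by move=> _ ->; exists [::]; rewrite /=.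
rewrite K => /andP[dc /IH{}IH] /IH[p wp cp].
(* A pause in the walk is no edge and is dropped, which can only lower the count. *)
case: (eqVneq (neighbour d v) v) => [e|ne].
  by exists p; [rewrite -{1}e | apply: leq_trans cp _; apply: leq_addl].
exists ((colour d, neighbour d v) :: p).
  rewrite /= /restrict_edge /= wp neighbourP // !andbT.
  by move: dc; rewrite /colour; clear; lia.
by rewrite /= colour_inj leq_add2l.
Qed.

(* The letters below m fill the start of the bottom row. *)
Definition padded (t : seq nat) : seq nat := nseq m.-1 0 ++ t.

Lemma yam_padded t : yam t -> yam (padded t).
Proof.
have F s r : yam_from s r -> yam_from (nseq m.-1 0 ++ s) r.
  elim: r s => //= x r IH s /andP[ax /IH]; rewrite rcons_cat => ->; rewrite andbT.
  move: ax; rewrite /addable !cnt_cat; case: x => //= x.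
  have -> : cnt x.+1 (nseq m.-1 0) = 0 by rewrite /cnt count_nseq.
  by move=> lt; apply: leq_trans lt (leq_addl _ _).
move=> yt; rewrite /padded yam_cat; apply/andP; split; last by have := F [::] t yt;
  rewrite cats0.
have N0 l s : yam_from s (nseq l 0) by elim: l s => //= l IH s; rewrite IH.
exact: N0.
Qed.

(** The padded labels have [n] letters, and a move of colour [c] on them becomes the dual
    equivalence of index [colour c] on reading words. Faithfulness makes the map to tableaux
    injective on the component, and paths of tableaux lift edge by edge. *)
Lemma structured_local a b : m < n -> m <= a -> b <= n ->
  structured neighbour sign letters -> locally_syt G a b.
Proof.
move=> mn ma bn [phi C F] v.
pose w (u : G) := padded (phi u).
have sw u : size (w u) = n.
  by rewrite size_cat size_nseq (cover_size C); move: mn m_gt0; rewrite /letters; clear; lia.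
have yw u : yam (w u) by apply/yam_padded/(cover_yam C).
pose lam := shape (tab (w v)).
have slam : sumn lam = n by rewrite -size_flatten (perm_size (perm_tab _)) size_iota sw.
have Lc c : a < colour c < b -> c.+2 < letters.
  by rewrite colour_lt; move: ma bn; clear; lia.
have wE c u : a < colour c < b -> w (neighbour c u) = dmove (c + m.-1) (w u).
  move=> /Lc cL; rewrite /w /padded (cover_E C) // addnC.
  by have := dmove_cat c (nseq m.-1 0) (phi u); rewrite size_nseq => ->.
pose H := restrict a b G.
have colP i : a < i < b -> exists2 c, i = colour c & a < colour c < b.
  move=> /andP[ai ib]; exists (i - m.+1); first by rewrite /colour subnK // (leq_ltn_trans ma).
  by rewrite /colour subnK ?ai // (leq_ltn_trans ma).
have connP u : connected (v : H) (u : H) -> reach neighbour (lower letters) v u.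
  move=> /connectP[p]; elim: p (v) => [|x p IH] y /=; first by move=> _ ->; apply: reach_refl.
  move=> /andP[/existsP[i /andP[/= ab e]] /IH{}IH] /IH{}IH.
  have [c ic abc] := colP _ ab; rewrite ic edgeE in e; case/andP: e => /eqP e _.
  by rewrite -e in IH; apply: reach_trans IH; apply: reach1; apply: Lc.
have permP u : connected (v : H) (u : H) -> perm_eq (w v) (w u).
  by move=> /connP vu; rewrite perm_cat2l (cover_perm C).
have sytP u : connected (v : H) (u : H) -> tab (w u) \in syt_seq lam.
  by move=> /permP pe; rewrite mem_syt_seq /lam (shape_tab_perm pe) tab_syt.
have vv : connected (v : H) (v : H) by apply: connect0.
pose T0 : syt lam := SeqSub (sytP v vv).
pose g (u : G) : syt lam := insubd T0 (tab (w u)).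
have gE u : connected (v : H) (u : H) -> val (g u) = tab (w u).
  by move=> vu; rewrite insubdK //; apply: (sytP).
pose rd u := reading_word (val (g u)).
have rdE c u : a < colour c < b -> connected (v : H) (u : H) ->
    rd (neighbour c u) = dual_equiv (colour c) (rd u) /\
    connected (v : H) (neighbour c u : H).
  move=> abc vu; have vu' : connected (v : H) (neighbour c u : H).
    case: (eqVneq (neighbour c u) u) => [->//|ne].
    apply: connect_trans vu (connect1 _); apply/existsP.
    have cb : colour c < b by case/andP: abc.
    by exists (Ordinal cb); rewrite /= /restrict_edge /= abc neighbourP.
  split=> //; rewrite /rd !gE // wE // reading_dmove.
    by congr dual_equiv; move: m_gt0; rewrite /colour; clear; lia.
  by rewrite sw; move: abc bn m_gt0; rewrite /colour; clear; lia.
have ginj u u' : connected (v : H) (u : H) -> connected (v : H) (u' : H) -> g u = g u' -> u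
  = u'.
  move=> vu vu' /(congr1 val); rewrite !gE // => /tab_inj; rewrite !sw => /(_ erefl).
  rewrite /w /padded => /(cat_inj erefl)[_]; apply: F.
  apply: reach_trans (connP _ vu'); apply: reach_sym (connP _ vu).
  by move=> c x _; apply: neighbourK.
have word_eq u (X : syt lam) : rd u = reading_word (val X) -> g u = X.
  move=> e; apply: val_inj.
  exact: reading_inj (syt_word (g u)).1 (syt_word X).1 e.
(* Any tableau adjacent to the label of [u] is the label of a neighbour of [u]. This yields both the
   edges of the image and the lifting of paths. *)
have dual_sym i (X : syt lam) u : 1 < i < sumn lam -> connected (v : H) (u : H) -> a < i < b ->
    (reading_word (val X) == dual_equiv i (rd u)) || (rd u == dual_equiv i (reading_word
      (val X))) ->
    exists2 c, i = colour c & X = g (neighbour c u).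
  move=> rng vu abi XE; have [c ic abc] := colP _ abi; subst i; exists c => //.
  have [e _] := rdE c u abc vu; apply/esym/word_eq; rewrite e.
  have sX := (syt_word X).2.
  have su : std_word (sumn lam) (rd u) := (syt_word (g u)).2.
  case/orP: XE => /eqP E; first by rewrite E.
  have sd : std_word (sumn lam) (dual_equiv (colour c) (rd u)).
    by rewrite -e; apply: (syt_word (g (neighbour c u))).2.
  apply: (positions_inj sd sX).
  by rewrite (positions_dual su rng) E (positions_dual sX rng) dmoveK.
pose HT := restrict a b (syt_graph lam).
have edgeP i (u u' : G) : a < i < b -> connected (v : H) (u : H) -> connected (v : H) (u' :
  H) ->
    syt_edge i (g u) (g u') = edge i u u'.
  move=> abi vu vu'; apply/idP/idP.
    move=> /and3P[rng ne XE]; have [c ic XE'] := dual_sym i _ u rng vu abi XE; subst i.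
    have [_ vn] := rdE c u abi vu.
    by rewrite edgeE -(ginj _ _ vu' vn XE') eqxx; apply: contraNneq ne => ->.
  move=> e; have [c ic abc] := colP _ abi; subst i.
  move: e; rewrite edgeE => /andP[/eqP eu ne]; have [er _] := rdE c u abc vu.
  rewrite /syt_edge /= -/(rd u) -/(rd u') -eu er eqxx andbT slam eu; apply/andP; split.
    by move: abc bn ma m_gt0; clear; lia.
  by apply: contraNneq ne => /(ginj _ _ vu vu') ->.
have gpath p (y : H) : connected (v : H) y -> connected (g v : HT) (g y : HT) ->
    path (@adjacent _ _ H) y p -> connected (g v : HT) (g (last y p) : HT).
  elim: p y => //= x p IH y vy gy /andP[/existsP[i /andP[/= abi e]] pp].
  have ib : i < b by case/andP: abi.
  have vx : connected (v : H) (x : H).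
    apply: connect_trans vy (connect1 _); apply/existsP; exists (Ordinal ib).
    by rewrite /= /restrict_edge /= abi.
  apply: (IH _ vx _ pp); apply: connect_trans gy (connect1 _).
  apply/existsP; exists (Ordinal ib).
  by rewrite /= /restrict_edge /= abi /= edgeP.
have gconn u : connected (v : H) (u : H) -> connected (g v : HT) (g u : HT).
  by move=> /connectP[p pp ->]; apply: gpath pp => //; apply: connect0.
have surj p (u : H) : connected (v : H) u -> path (@adjacent _ _ HT) (g u) p ->
    exists2 u' : H, connected (v : H) u' & g u' = last (g u : HT) p.
  elim: p u => [|Y p IH] u vu /=; first by exists u.
  move=> /andP[/existsP[i /andP[/= abi /and3P[rng ne XE]]] pp].
  have [c ic YE] := dual_sym i _ u rng vu abi XE; rewrite ic in abi.
  have [_ vn] := rdE c u abi vu.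
  by rewrite YE in pp *; apply: IH.
have gsurj X : connected (g v : HT) X -> exists2 u, connected (v : H) (u : H) & g u = X.
  by move=> /connectP[p pp ->]; apply: surj.
pose f (x : component (v : H)) : component (g v : HT) :=
  exist (fun X : HT => connected (g v : HT) X) (g (val x)) (gconn _ (valP x)).
exists lam, (g v : HT); split.
- exact: tab_partition.
- by rewrite slam.
exists f; split.
  apply: inj_surj_bij => [x y /(congr1 val) /= e|[X cX]].
    by apply: val_inj; apply: ginj e; [apply: (valP x)|apply: (valP y)].
  have [u vu e] := gsurj X cX; exists (exist (fun w : H => connected (v : H) w) u vu).
  exact: val_inj.
move=> i x y; rewrite /= /component_edge /= /restrict_edge /=.
case: (boolP (a < i < b)) => //= abi; exact: edgeP abi (valP x) (valP y).
Qed.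
End Translation.

Theorem theorem3p17 (m n N : nat) (m_gt0 : 0 < m) (n_gt0 : 0 < n)
    (le_nN : n <= N) (G : scgraph m n N) :
  [/\ axiom1 G, axiom2 G, axiom3 G, axiom4plus G & axiom5 G]
  <-> dual_equivalence_graph G.
Proof.
split=> [[A1 A2 A3 A4p A5]|[[A1 A2 A3] [A4 A5 A6]]].
  have small k B d v : orbits_bounded k B -> 1 < k <= 4 -> d + k.+1 < letters m n ->
      reach_bounded (@neighbour m n N G) (fun x => d <= x < d + k) v B.
    move=> bnd k4 dk.
    (* The last colour of the window is [i = d + m + k]. The bound [1 < k] puts it above [m.+1], and
       [k <= 4] keeps the window within the four colours that Axiom 4+ provides at [i]. *)
    have ir : m.+1 < d + m + k < n by move: k4 dk; rewrite /letters; clear; lia.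
    apply: (local_bound bnd (A4p _ ir)) => //.
    by move: k4; clear; lia.
  have D : dual_graph (@neighbour m n N G) (@sign m n N G) (letters m n).
    apply: translate => // d v dL.
      by apply: small orbits_bounded2 _ _; rewrite // addn3.
    by apply: small orbits_bounded3 _ _; rewrite // addn4.
  have [S few] : structured (@neighbour m n N G) (@sign m n N G) (letters m n) /\
      forall c, c.+2 < letters m n -> few_top (@neighbour m n N G) c.
    by apply: (small_structured D) => // d v dL; apply: small orbits_bounded4 _ _.
  split=> //; split=> //; last by apply/axiom6E.
  move=> i mi; apply: structured_local => //; move: mi; clear; lia.
have small k B d v : orbits_bounded k B -> 1 < k <= 3 -> d + k.+1 < letters m n ->
    reach_bounded (@neighbour m n N G) (fun x => d <= x < d + k) v B.
  move=> bnd k4 dk.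
  have ir : m.+1 < d + m + k < n by move: k4 dk; rewrite /letters; clear; lia.
  apply: (local_bound bnd (A4 _ ir)) => //.
  by move: k4; clear; lia.
have D : dual_graph (@neighbour m n N G) (@sign m n N G) (letters m n).
  apply: translate => // d v dL.
    by apply: small orbits_bounded2 _ _; rewrite // addn3.
  by apply: small orbits_bounded3 _ _; rewrite // addn4.
have few : forall c, c.+2 < letters m n -> few_top (@neighbour m n N G) c by apply/axiom6E.
have S := few_top_structured D few (ltn0Sn _).
split=> // i mi; apply: structured_local => //; move: mi; clear; lia.
Qed.
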